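(* Let $L$ be a real-valued functional defined on the finite subsets of $[0,1]^2$, and assume that for a certain constant $\kappa$ the following condition holds: whenever $k\ge1$, $C\in\mathcal C_k$, $F\subset[0,1]^2$ is finite and such that every $C'\in\mathcal C_{k-1}$ that is within distance $2^{-k+3}$ of $C$ meets $F$, and $G\subset C$ is finite, then $$|L(F)-L(F\cup G)|\le\kappa2^{-k}\,\mathrm{card}\big((F\cup G)\cap B(C,\kappa2^{-k})\big).$$ Then there is a constant $K$ depending only on $\kappa$ such that, for every $N\ge1$, if $X_1,\dots,X_N$ are independent and uniformly distributed over $[0,1]^2$, $L_N=L(\{X_1,\dots,X_N\})$, and $M$ is a median of $L_N$, then $$\forall t>0,\qquad P(|L_N-M|\ge t)\le K\exp\Big(-\frac1K\min\big(t^2,(t\sqrt N)^{2/3}\big)\Big).$$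
   Context: For $k\ge0$, $\mathcal C_k$ denotes the family of the $2^{2k}$ dyadic squares of side $2^{-k}$ contained in $[0,1]^2$, i.e. those whose vertices are of the form $(\ell_12^{-k},\ell_22^{-k})$ with integers $0\le\ell_1,\ell_2\le2^k$ (so $\mathcal C_0=\{[0,1]^2\}$). $B(C,r)$ denotes the set of points within (Euclidean) distance $r$ of $C$. All functions are treated as measurable. *)

(* Defs.v *)
From HB Require Import structures.
From mathcomp Require Import all_boot all_order all_algebra finmap.
From mathcomp Require Import all_classical all_reals all_analysis.
Set Implicit Arguments.
Unset Strict Implicit.
Unset Printing Implicit Defensive.
Import Order.TTheory GRing.Theory Num.Theory.
Import numFieldNormedType.Exports.
Local Open Scope classical_set_scope.
Local Open Scope ring_scope.

Section Squares.
Variable R : realType.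
Implicit Types (C : set (R * R)) (k : nat).

Definition unit_square : set (R * R) := `[0, 1] `*` `[0, 1].

(* The norm that MathComp-Analysis puts on R * R is the sup norm, hence this
   explicit Euclidean distance. *)
Definition edist (x y : R * R) : R :=
  Num.sqrt ((x.1 - y.1) ^+ 2 + (x.2 - y.2) ^+ 2).

(* B(C, r). All sets C it is applied to are nonempty and compact, so that
   being at distance at most r from C is the same as being at distance at most
   r from some point of C. *)
Definition nbhd C (r : R) : set (R * R) :=
  [set x | exists2 y, C y & edist x y <= r].

Definition within_distance (r : R) C C' : Prop := C' `&` nbhd C r !=set0.

Definition dyadic_square k (l1 l2 : nat) : set (R * R) :=
  `[l1%:R / 2 ^+ k, l1.+1%:R / 2 ^+ k] `*` `[l2%:R / 2 ^+ k, l2.+1%:R / 2 ^+ k].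

Definition dyadic_squares k : set (set (R * R)) :=
  [set C | exists l1 l2 : nat,
    [/\ (l1 < 2 ^ k)%N, (l2 < 2 ^ k)%N & C = dyadic_square k l1 l2]].

End Squares.
Arguments unit_square {R}.

Section Functionals.
Variable R : realType.

(* Functionals on the finite subsets of the unit square are represented by
   functions on all finite subsets of the plane; the values on sets that are
   not contained in the unit square are never used. *)
Implicit Type L : {fset R * R} -> R.

Definition local_condition (kappa : R) L : Prop :=
  forall (k : nat) (C : set (R * R)) (F G : {fset R * R}),
    (1 <= k)%N -> dyadic_squares k C ->
    [set` F] `<=` unit_square ->
    (forall C', dyadic_squares k.-1 C' ->
       within_distance (2 ^ (3 - k%:Z)) C C' -> C' `&` [set` F] !=set0) ->
    [set` G] `<=` C ->
    `|L F - L (F `|` G)%fset| <=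
      kappa * 2 ^- k *
      #|` [fset x in (F `|` G)%fset | x \in nbhd C (kappa * 2 ^- k)]%fset|%:R.

Definition on_points L (n : nat) (x : n.-tuple (R * R)) : R :=
  L [fset tnth x i | i in 'I_n]%fset.

(* Measurability is required of L itself, through (x_1, ..., x_n) |->
   L {x_1, ..., x_n} on the n-fold product of the unit square. *)
Definition measurable_functional L : Prop :=
  forall n : nat,
    measurable_fun [set x : n.-tuple (R * R) | forall i, unit_square (tnth x i)]
      (@on_points L n).

End Functionals.

Section RandomVariables.
Context d (T : measurableType d) (R : realType) (P : probability T R).

Definition mutually_independent d' (E : measurableType d') (I : finType)
    (X : I -> {RV P >-> E}) : Prop :=
  forall (J : {set I}) (B : I -> set E), (forall i, measurable (B i)) ->
    P (\bigcap_(i in [set` J]) (X i @^-1` B i)) =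
    (\prod_(i in J) P (X i @^-1` B i))%E.

(* X takes all its values in the square, where functionals are meaningful; the
   square has area 1, so no normalization of Lebesgue measure is needed. *)
Definition uniform_on_unit_square (X : {RV P >-> (R * R)%type}) : Prop :=
  (forall w, unit_square (X w)) /\
  forall B : set (R * R), measurable B ->
    distribution P X B =
    (@lebesgue_measure R \x @lebesgue_measure R)%E (B `&` unit_square).

Definition is_median (Y : T -> R) (M : R) : Prop :=
  (2^-1%:E <= P [set w | (Y w <= M)%R])%E /\
  (2^-1%:E <= P [set w | (M <= Y w)%R])%E.

End RandomVariables.

(* Main.v *)
Require Import Defs.
From HB Require Import structures.
From mathcomp Require Import all_boot all_order all_algebra finmap.
From mathcomp Require Import all_classical all_reals all_analysis.
From mathcomp Require Import measurable_realfun.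
From mathcomp Require Import zify ring lra.
Import Order.TTheory GRing.Theory Num.Theory.
Import numFieldNormedType.Exports.
Local Open Scope classical_set_scope.
Local Open Scope ring_scope.

Set Implicit Arguments.
Unset Strict Implicit.
Unset Printing Implicit Defensive.

(* Let w, w' be two independent copies of the sample. Since both sides of the
   median have probability at least 1/2, it suffices to bound the probability
   that L(w) - L(w') is large. Resample first one half J of the indices and
   then the other half, so that in each step the points with index outside of
   J are fixed. Exchanging the two copies of the points with index in J leaves
   the joint law invariant, so one may average over all exchanges; once the
   unordered pairs are fixed, the difference is an odd function on the
   hypercube, to which Hoeffding's bounded differences inequality applies.

   The fixed points determine the scale at which the local condition may be
   used near a given point: the finest level, at most log_4 N, at which the
   cell of the point is admissible. Adding points of a cell of level k costs
   at most a constant times 2^-k times the number of points nearby. A used cell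
   of a coarse level has an empty cell close by, so large costs require either
   an empty cell or an overfull one. Union bounds over families of such cells
   give the following, outside of an event of probability exp(- 4^lam / C):
   the points of used cells of size at least 4^l0 have total cost
   C 8^lam / sqrt N, and the squared costs of the other points have a bounded
   sum. The exponent (t sqrt N)^(2/3) results from 8^lam = c t sqrt N. *)

(** * Bounded differences on the hypercube *)

(** The obstacle is that costs must not change under exchanges, while the local condition asks for a
    set that is already well spread. Hence admissibility refers to the fixed points alone, which
    belong to every set that occurs, and costs count the points of both copies. The local condition
    charges a cell and its surroundings once for all points added in the cell. Thus the large used
    cells enter a plain sum with one term per cell; the others enter a sum of squares with one term
    per point, as bounded differences require. A used cell of depth [i] with about [4^l] points
    nearby costs about [2^i 4^l / sqrt N]. With [4^lam / 4^l] exceptional cells, [i <= l <= lam],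
    the plain sum is of order [8^lam / sqrt N], and the sum of squares over [l < l0] of order
    [4^(lam + 3 (l0 - 1)) / N]. Keeping the latter bounded dictates [4^(lam + 3 l0) ~ N], which is
    the choice of [l0]. The typical number of exceptional cells decays faster than any power of
    [4^l]; [4^(-5 l)] is kept because 5 is the least integer power for which the sum of squares,
    with weights [4^l 64^l], converges. *)

Section Hypercube.
Variables (R : realType) (I : finType).
Implicit Types (g : {ffun I -> bool} -> R) (s : {ffun I -> bool}).

(** The sharp exponent is [x^2 / 2]; a factor 4 is given away to keep the proof elementary. For
    [0 <= x <= 1/2] the bounds [1 - x <= expR (- x)] and [1 + x <= expR x] are inverted; beyond
    that, [x <= 2 * x^2]. *)
Lemma expR_sum_opp_le (x : R) : expR x + expR (- x) <= 2 * expR (2 * x ^+ 2).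
Proof.
wlog x0 : x / 0 <= x.
  move=> h; case: (leP 0 x) => [/h //|x0].
  by rewrite addrC -{2}(opprK x) -(sqrrN x); apply: h; rewrite oppr_ge0 ltW.
case: (leP (2 * x) 1) => x1.
- have y1 : 0 < 1 - x by lra.
  have y2 : 0 < 1 + x by lra.
  have e1 : expR x <= (1 - x)^-1.
    rewrite -[x in expR x]opprK expRN lef_pV2 ?posrE ?expR_gt0//.
    exact: expR_ge1Dx.
  have e2 : expR (- x) <= (1 + x)^-1.
    by rewrite expRN lef_pV2 ?posrE ?expR_gt0// expR_ge1Dx.
  apply: (le_trans (lerD e1 e2)).
  have -> : (1 - x)^-1 + (1 + x)^-1 = 2 / (1 - x ^+ 2).
    have y3 : 0 < 1 - x ^+ 2.
      by rewrite (_ : 1 - _ = (1 - x) * (1 + x)) ?mulr_gt0//; ring.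
    by field; rewrite !gt_eqF.
  have y3 : 0 < 1 - x ^+ 2.
    by rewrite (_ : 1 - _ = (1 - x) * (1 + x)) ?mulr_gt0//; ring.
  rewrite ler_pM2l//; apply: (@le_trans _ _ (1 + 2 * x ^+ 2)).
    rewrite -div1r ler_pdivrMr//.
    rewrite (_ : (1 + _) * _ = 1 + x ^+ 2 * (1 - 2 * x ^+ 2)); last by ring.
    by rewrite lerDl mulr_ge0 ?sqr_ge0//; nra.
  exact: expR_ge1Dx.
- have h1 : expR x <= expR (2 * x ^+ 2) by rewrite ler_expR; nra.
  have h2 : expR (- x) <= expR (2 * x ^+ 2) by rewrite ler_expR; nra.
  lra.
Qed.

Definition flip (i : I) s : {ffun I -> bool} :=
  [ffun j => if j == i then ~~ s j else s j].

Lemma flipK i : involutive (flip i).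
Proof.
by move=> s; apply/ffunP => j; rewrite !ffunE; case: eqP => // _; rewrite negbK.
Qed.

Lemma flipC i j s : flip i (flip j s) = flip j (flip i s).
Proof. by apply/ffunP => x; rewrite !ffunE; do 2 case: eqP. Qed.

Lemma flip_invariant_const g :
  (forall i s, g (flip i s) = g s) -> forall s s', g s = g s'.
Proof.
move=> gi s s'.
(* Interpolates between [s] and [s']: the coordinates listed in [r] are already switched to [s']. *)
pose m (r : seq I) : {ffun I -> bool} :=
  [ffun j => if j \in r then s' j else s j].
have mP r : uniq r -> g (m r) = g s.
  elim: r => [_|i r IH /= /andP[ir ur]].
    by congr g; apply/ffunP => j; rewrite ffunE.
  rewrite -IH//; have [e|e] := eqVneq (s i) (s' i).
    congr g; apply/ffunP => j; rewrite !ffunE inE; case: eqP => //= ->.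
    by rewrite (negbTE ir) e.
  rewrite -(gi i (m r)); congr g; apply/ffunP => j; rewrite !ffunE inE.
  case: eqP => //= ->; rewrite (negbTE ir).
  by case: (s i) (s' i) e => -[].
rewrite -(mP (enum I)) ?enum_uniq//; congr g; apply/ffunP => j.
by rewrite ffunE mem_enum.
Qed.

Lemma sum_flip g i : \sum_s g (flip i s) = \sum_s g s.
Proof.
symmetry; rewrite (reindex_inj (h := flip i))//.
exact: inv_inj (flipK i).
Qed.

Lemma card_hypercube : #|{ffun I -> bool}| = (2 ^ #|I|)%N.
Proof. by rewrite card_ffun card_bool. Qed.

(* Induction on the coordinates on which [g] depends: averaging over one flip
   removes a coordinate and costs a hyperbolic cosine. *)
Lemma expR_hypercube_seq g (c : I -> R) (r : seq I) : uniq r ->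
  (forall i s, `|g s - g (flip i s)| <= c i) ->
  (forall i s, i \notin r -> g (flip i s) = g s) ->
  \sum_s g s = 0 ->
  \sum_s expR (g s) <= 2 ^+ #|I| * expR (2^-1 * \sum_(i <- r) c i ^+ 2).
Proof.
elim: r g => [|i r IH] g /=.
  move=> _ _ gi g0.
  have gc s : g s = 0.
    have cst s' : g s' = g s by apply: flip_invariant_const => j u; apply: gi.
    move: g0; rewrite (eq_bigr (fun=> g s)); last by move=> s' _; exact: cst.
    move/eqP; rewrite big_const iter_addr addr0 mulrn_eq0.
    rewrite card_hypercube expn_eq0/=.
    by move/eqP.
  rewrite (eq_bigr (fun=> 1)) => [|s _]; last by rewrite gc expR0.
  rewrite big_nil mulr0 expR0 mulr1 big_const iter_addr addr0 card_hypercube.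
  by rewrite natrX.
move=> /andP[ir ur] gc gi g0.
pose h s := 2^-1 * (g s + g (flip i s)).
have hs : \sum_s h s = 0.
  by rewrite -mulr_sumr big_split/= sum_flip g0 addr0 mulr0.
have hc j s : `|h s - h (flip j s)| <= c j.
  rewrite /h -mulrBr normrM ger0_norm// flipC ler_pdivrMl// opprD addrACA.
  by rewrite (le_trans (ler_normD _ _))// mulrDl mul1r lerD.
have hi j s : j \notin r -> h (flip j s) = h s.
  move=> jr; rewrite /h; have [->|ji] := eqVneq j i.
    by rewrite flipK addrC.
  have jir : j \notin i :: r by rewrite inE negb_or ji jr.
  by rewrite flipC !(gi j _ jir).
have := IH h ur hc hi hs; rewrite big_cons mulrDr expRD mulrCA => IH'.
have le1 : \sum_s expR (g s) <= \sum_s expR (h s) * expR (2^-1 * c i ^+ 2).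
  have -> : \sum_s expR (g s) =
            \sum_s 2^-1 * (expR (g s) + expR (g (flip i s))).
    rewrite -mulr_sumr big_split/= (sum_flip (fun s => expR (g s))).
    by field.
  apply: ler_sum => s _.
  pose d := 2^-1 * (g s - g (flip i s)).
  have -> : g s = h s + d by rewrite /h/d; field.
  have -> : g (flip i s) = h s - d by rewrite /h/d; field.
  rewrite !expRD -mulrDr mulrCA ler_pM2l ?expR_gt0//.
  rewrite ler_pdivrMl//; apply: (le_trans (expR_sum_opp_le d)).
  rewrite ler_pM2l// ler_expR.
  have : d ^+ 2 <= (2^-1 * c i) ^+ 2.
    rewrite -(real_normK (num_real d)) lerXn2r ?nnegrE//.
      by rewrite mulr_ge0// (le_trans _ (gc i s)).
    by rewrite /d normrM ger0_norm// ler_pM2l.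
  nra.
apply: (le_trans le1); rewrite -mulr_suml mulrC.
by rewrite ler_pM2l ?expR_gt0.
Qed.

Lemma hypercube_tail g (c : I -> R) (V t : R) :
  (forall i s, `|g s - g (flip i s)| <= c i) ->
  \sum_s g s = 0 ->
  \sum_i c i ^+ 2 <= V -> 0 < V -> 0 < t ->
  #|[set s | t <= g s]%SET|%:R <= 2 ^+ #|I| * expR (- (t ^+ 2 / (2 * V))).
Proof.
move=> gc g0 cV V0 t0.
(* The minimizer of [V * lam^2 / 2 - lam * t], the exponent in the exponential Markov inequality. *)
pose lam := t / V.
have lam0 : 0 < lam by rewrite divr_gt0.
have := @expR_hypercube_seq (fun s => lam * g s) (fun i => lam * c i) (enum I)
  (enum_uniq _).
move=> H.
have {H} : \sum_s expR (lam * g s) <=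
    2 ^+ #|I| * expR (2^-1 * \sum_(i <- enum I) (lam * c i) ^+ 2).
  apply: H => [i s|i s|].
  - by rewrite -mulrBr normrM gtr0_norm// ler_pM2l.
  - by rewrite mem_enum.
  - by rewrite -mulr_sumr g0 mulr0.
rewrite big_enum /= => H.
have H1 : #|[set s | t <= g s]%SET|%:R * expR (lam * t) <= \sum_s expR (lam * g s).
  rewrite -sum1_card natr_sum mulr_suml big_mkcond/=.
  apply: ler_sum => s _; rewrite inE; case: ifP => [ts|_].
    by rewrite mul1r ler_expR ler_pM2l.
  by rewrite expR_ge0.
have H2 := le_trans H1 H.
rewrite -(ler_pM2r (expR_gt0 (lam * t))); apply: (le_trans H2).
rewrite -mulrA ler_pM2l ?exprn_gt0// -expRD ler_expR.
under eq_bigr do rewrite exprMn.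
rewrite -mulr_sumr.
have : lam ^+ 2 * (\sum_i c i ^+ 2) <= lam ^+ 2 * V by rewrite ler_pM2l ?exprn_gt0.
have -> : lam ^+ 2 * V = t ^+ 2 / V by rewrite /lam; field; rewrite gt_eqF.
have -> : lam * t = t ^+ 2 / V by rewrite /lam; field; rewrite gt_eqF.
have -> : t ^+ 2 / (2 * V) = 2^-1 * (t ^+ 2 / V) by field; rewrite gt_eqF.
lra.
Qed.

End Hypercube.

(** * Dyadic cells *)

Section CellIndex.
Variable R : realType.
Implicit Types (x y p : R) (z : R * R) (k c : nat).

Definition idx_near n a b := ((a <= b + n) && (b <= a + n))%N.

Lemma near_sym n a b : idx_near n a b = idx_near n b a.
Proof. by rewrite /idx_near andbC. Qed.

(* The right endpoint 1 is put in the last cell. *)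
Definition cidx k x : nat := minn (Num.truncn (2 ^+ k * x)) (2 ^ k).-1.

Lemma cidx_lt k x : (cidx k x < 2 ^ k)%N.
Proof. by rewrite /cidx gtn_min ltn_predL expn_gt0 orbT. Qed.

Lemma cidx_itv k x : 0 <= x <= 1 ->
  (cidx k x)%:R / 2 ^+ k <= x <= (cidx k x).+1%:R / 2 ^+ k.
Proof.
move=> /andP[x0 x1]; have k0 : 0 < 2 ^+ k :> R by rewrite exprn_gt0.
rewrite ler_pdivrMr// ler_pdivlMr// [x * _]mulrC.
have u0 : 0 <= 2 ^+ k * x by rewrite mulr_ge0// ltW.
have /andP[h1 h2] := truncn_itv u0.
apply/andP; split.
  by apply: le_trans h1; rewrite ler_nat geq_minl.
rewrite /cidx /minn; case: ifP => _; first exact: ltW.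
by rewrite prednK ?expn_gt0// natrX ler_piMr// ltW.
Qed.

Lemma cidx_near k c a p y : 0 <= p <= 1 ->
  c%:R / 2 ^+ k <= y <= c.+1%:R / 2 ^+ k -> `|p - y| <= a%:R / 2 ^+ k ->
  idx_near a.+1 c (cidx k p).
Proof.
move=> /(cidx_itv k); have k0 : 0 < 2 ^+ k :> R by rewrite exprn_gt0.
have ik0 : 0 < (2 ^+ k)^-1 :> R by rewrite invr_gt0.
move=> /andP[h1 h2] /andP[h3 h4]; rewrite ler_norml => /andP[h5 h6].
rewrite /idx_near; apply/andP; split; rewrite -(ler_nat R) natrD -(ler_pM2r ik0);
  move: h1 h2 h3 h4 h5 h6; rewrite -!natr1 !mulrDl !mul1r; lra.
Qed.

Lemma edist_fst z z' : `|z.1 - z'.1| <= Defs.edist z z'.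
Proof. by rewrite -sqrtr_sqr ler_wsqrtr// lerDl sqr_ge0. Qed.

Lemma edist_snd z z' : `|z.2 - z'.2| <= Defs.edist z z'.
Proof. by rewrite -sqrtr_sqr ler_wsqrtr// lerDr sqr_ge0. Qed.

Lemma unit_squareP z : unit_square z -> (0 <= z.1 <= 1) /\ (0 <= z.2 <= 1).
Proof. by case=> /=; rewrite !in_itv/=. Qed.

Lemma dyadic_squareP k c1 c2 z : dyadic_square k c1 c2 z <->
  (c1%:R / 2 ^+ k <= z.1 <= c1.+1%:R / 2 ^+ k) /\
  (c2%:R / 2 ^+ k <= z.2 <= c2.+1%:R / 2 ^+ k).
Proof. by rewrite /dyadic_square /setX /= !in_itv. Qed.

Lemma cidx_square k z : unit_square z ->
  dyadic_square k (cidx k z.1) (cidx k z.2) z.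
Proof.
by move=> /unit_squareP[h1 h2]; apply/dyadic_squareP; split; exact: cidx_itv.
Qed.

Lemma nbhd_near k c1 c2 a z : unit_square z ->
  nbhd (dyadic_square k c1 c2) (a%:R / 2 ^+ k) z ->
  idx_near a.+1 c1 (cidx k z.1) && idx_near a.+1 c2 (cidx k z.2).
Proof.
move=> /unit_squareP[h1 h2] [y /dyadic_squareP[y1 y2] dzy].
apply/andP; split.
  exact: (cidx_near h1 y1 (le_trans (edist_fst z y) dzy)).
exact: (cidx_near h2 y2 (le_trans (edist_snd z y) dzy)).
Qed.

Lemma exprz_3sub k : (2 : R) ^ (3 - k%:Z) = 8 / 2 ^+ k.
Proof.
rewrite expfzDr// -exprnN; congr (_ * _).
by rewrite -exprnP; ring.
Qed.

(** The distance [8 / 2^(k+1)] is 4 sides of level [k], and the cell of level [k+1] adds half a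
    side. Rounded up this is 5, to which [cidx_near] adds 1. *)
Lemma within_distance_near k c1 c2 z : unit_square z ->
  within_distance ((2 : R) ^ (3 - k.+1%:Z))
    (dyadic_square k.+1 (cidx k.+1 z.1) (cidx k.+1 z.2))
    (dyadic_square k c1 c2) ->
  idx_near 6 c1 (cidx k z.1) && idx_near 6 c2 (cidx k z.2).
Proof.
move=> uz [v [/dyadic_squareP[v1 v2] [y /dyadic_squareP[y1 y2] dyv]]].
have [z1 z2] := unit_squareP uz.
have /dyadic_squareP[w1 w2] := cidx_square k.+1 uz.
move: dyv; rewrite exprz_3sub => dyv.
have ik0 : 0 < (2 ^+ k)^-1 :> R by rewrite invr_gt0 exprn_gt0.
have h (a b c : R) n m :
    n%:R / 2 ^+ k.+1 <= b <= n.+1%:R / 2 ^+ k.+1 ->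
    n%:R / 2 ^+ k.+1 <= c <= n.+1%:R / 2 ^+ k.+1 ->
    `|a - b| <= 8 / 2 ^+ k.+1 ->
    m%:R / 2 ^+ k <= a <= m.+1%:R / 2 ^+ k -> `|c - a| <= 5%:R / 2 ^+ k.
  move=> /andP[h1 h2] /andP[h3 h4] + _.
  rewrite !ler_norml => /andP[h5 h6]; move: h1 h2 h3 h4 h5 h6.
  rewrite exprS invfM -[n.+1%:R]natr1 !mulrDl !mul1r => *.
  by apply/andP; split; lra.
apply/andP; split.
  apply: (cidx_near z1 v1); apply: h y1 w1 _ v1 => //.
  exact: le_trans (edist_fst _ _) dyv.
apply: (cidx_near z2 v2); apply: h y2 w2 _ v2 => //.
exact: le_trans (edist_snd _ _) dyv.
Qed.

End CellIndex.

(** * Cells of all levels in one finite type *)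

Section Cells.
Variables (R : realType) (K : nat).
Implicit Types (z : R * R) (k n : nat).

(** One type serves all levels [k <= K], with [valid k] singling out the indices of level [k]. The
    form [.-1.+1] presents [2 ^ K] as a successor, as [inord] requires. *)
Definition cell := ('I_(2 ^ K).-1.+1 * 'I_(2 ^ K).-1.+1)%type.

Definition cell_of k z : cell := (inord (cidx k z.1), inord (cidx k z.2)).

Lemma cell_of_val k z : (k <= K)%N ->
  ((cell_of k z).1 = cidx k z.1 :> nat) * ((cell_of k z).2 = cidx k z.2 :> nat).
Proof.
move=> kK; rewrite /cell_of /=.
suff h (x : R) : (cidx k x < (2 ^ K).-1.+1)%N by rewrite !inordK.
rewrite prednK ?expn_gt0//; apply: leq_trans (cidx_lt k x) _.
by rewrite leq_exp2l.
Qed.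

Definition valid k : {set cell} :=
  [set c : cell | (c.1 < 2 ^ k)%N && (c.2 < 2 ^ k)%N]%SET.

Lemma cell_of_valid k z : (k <= K)%N -> cell_of k z \in valid k.
Proof. by move=> kK; rewrite inE !(cell_of_val z kK) !cidx_lt. Qed.

Lemma card_valid k : (k <= K)%N -> #|valid k| = (4 ^ k)%N.
Proof.
move=> kK.
have h : #|[set a : 'I_(2 ^ K).-1.+1 | (a < 2 ^ k)%N]%SET| = (2 ^ k)%N.
  have le : (2 ^ k <= (2 ^ K).-1.+1)%N by rewrite prednK ?expn_gt0// leq_exp2l.
  have winj : injective (widen_ord le).
    by move=> a b /(congr1 val) /= ab; exact/val_inj.
  rewrite -[RHS]card_ord -cardsT -(card_imset _ winj).
  apply: eq_card => a; rewrite inE; apply/idP/imsetP => [ak|[b _ ->]].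
    by exists (Ordinal ak) => //; exact/val_inj.
  exact: (ltn_ord b).
have -> : valid k = finset.setX [set a : 'I_(2 ^ K).-1.+1 | (a < 2 ^ k)%N]%SET
   [set a : 'I_(2 ^ K).-1.+1 | (a < 2 ^ k)%N]%SET.
  by apply/setP => c; rewrite !inE.
by rewrite cardsX h -expnMn.
Qed.

Definition near_cell n (c c' : cell) := idx_near n c.1 c'.1 && idx_near n c.2 c'.2.

Lemma near_cell_sym n c c' : near_cell n c c' = near_cell n c' c.
Proof. by rewrite /near_cell near_sym [idx_near n c.2 _]near_sym. Qed.

Lemma card_near_cell n c : (#|[set c' | near_cell n c c']%SET| <= (2 * n).+1 ^ 2)%N.
Proof.
have h (a : 'I_(2 ^ K).-1.+1) :
    (#|[set b : 'I_(2 ^ K).-1.+1 | idx_near n a b]%SET| <= (2 * n).+1)%N.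
  pose f (b : 'I_(2 ^ K).-1.+1) : 'I_(2 * n).+1 := inord (b + n - a)%N.
  rewrite -[leqRHS]card_ord -(card_in_imset (f := f)) ?max_card//.
  move=> b b'; rewrite !inE /idx_near => /andP[h1 h2] /andP[h3 h4].
  move=> /(congr1 val); rewrite /= !inordK; [|lia|lia].
  by move=> h; apply/val_inj => /=; lia.
have -> : [set c' | near_cell n c c']%SET =
    finset.setX [set b : 'I_(2 ^ K).-1.+1 | idx_near n c.1 b]%SET
      [set b : 'I_(2 ^ K).-1.+1 | idx_near n c.2 b]%SET.
  by apply/setP => c'; rewrite !inE.
by rewrite cardsX -mulnn leq_mul.
Qed.

Lemma card_near_ex n (Q : pred cell) :
  (#|[set c | [exists c', near_cell n c c' && Q c']]%SET| <=
   (2 * n).+1 ^ 2 * #|[set c | Q c]%SET|)%N.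
Proof.
have -> : [set c | [exists c', near_cell n c c' && Q c']]%SET =
    (\bigcup_(c' in [set c | Q c]) [set c | near_cell n c' c])%SET.
  apply/setP => c; rewrite inE; apply/existsP/finset.bigcupP => [[c' /andP[h1 h2]]|].
    by exists c'; rewrite inE // near_cell_sym.
  by move=> [c']; rewrite !inE => Qc' h; exists c'; rewrite near_cell_sym h.
apply: (@leq_trans (\sum_(c' in [set c | Q c]%SET) (2 * n).+1 ^ 2)).
  elim/big_rec2: _ => [|c' m A _ h]; first by rewrite cards0.
  by apply: leq_trans (leq_card_setU _ _) _; rewrite leq_add// card_near_cell.
by rewrite sum_nat_const mulnC.
Qed.

Lemma measurable_cidx k c : measurable [set x : R | cidx k x = c].
Proof.
have h n : measurable [set x : R | (n <= cidx k x)%N].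
  case: n => [|n].
    by rewrite (_ : mkset _ = setT)//; apply/seteqP; split.
  case: (leqP n.+1 (2 ^ k).-1) => hn; last first.
    rewrite (_ : mkset _ = set0)//; apply/seteqP; split=> x //=.
    by rewrite /cidx leq_min [(n < (2 ^ k).-1)%N]leqNgt hn andbF.
  rewrite (_ : mkset _ = `[n.+1%:R / 2 ^+ k, +oo[%classic).
    exact: measurable_itv.
  apply/seteqP; split=> x /=; rewrite /cidx leq_min hn andbT truncn_gt_nat;
    by rewrite in_itv/= andbT ler_pdivrMr ?exprn_gt0// mulrC.
have -> : [set x : R | cidx k x = c] =
    [set x : R | (c <= cidx k x)%N] `\` [set x : R | (c.+1 <= cidx k x)%N].
  apply/seteqP; split=> x /=; first by move=> <-; rewrite leqnn ltnn.
  by move=> [h1 /negP]; rewrite -leqNgt => h2; apply/eqP; rewrite eqn_leq h2.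
by apply: measurableD.
Qed.

Lemma measurable_cell_of k c : (k <= K)%N ->
  measurable (@cell_of k @^-1` [set c]).
Proof.
move=> kK.
have -> : @cell_of k @^-1` [set c] =
    [set x | cidx k x = c.1] `*` [set x | cidx k x = c.2].
  apply/seteqP; split=> z /=.
    by move=> <-; rewrite /setX/= !(cell_of_val z kK).
  case: c => c1 c2 [/= h1 h2]; congr pair; apply/val_inj => /=;
    by rewrite inordK ?h1 ?h2.
by apply: measurableX; exact: measurable_cidx.
Qed.

Lemma uniform_cell d (T : measurableType d) (P : probability T R)
    (X : {RV P >-> (R * R)%type}) k c : (k <= K)%N ->
  uniform_on_unit_square X ->
  (P (X @^-1` (@cell_of k @^-1` [set c])) <= (#|valid k|%:R^-1)%:E)%E.
Proof.
move=> kK [Xsq Xlaw].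
rewrite -[leLHS]/(distribution P X _) Xlaw; last exact: measurable_cell_of.
pose I (m : nat) : set R := `[m%:R / 2 ^+ k, m.+1%:R / 2 ^+ k]%classic.
have mI m : measurable (I m) by exact: measurable_itv.
have lI m : lebesgue_measure (I m) = ((2 ^+ k)^-1)%:E.
  rewrite lebesgue_measure_itv /= lte_fin ltr_pM2r ?invr_gt0 ?exprn_gt0//.
  rewrite ltr_nat ltnSn -EFinB -mulrBl -natr1; congr (_%:E).
  by rewrite addrC addKr mul1r.
apply: (@le_trans _ _
    ((@lebesgue_measure R \x @lebesgue_measure R)%E (I c.1 `*` I c.2))).
  apply: le_measure; rewrite ?inE.
  - apply: measurableI; first exact: measurable_cell_of.
    by apply: measurableX; exact: measurable_itv.
  - by apply: measurableX; exact: mI.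
  move=> z /= [<- zsq]; rewrite /setX/= !(cell_of_val z kK).
  by have [] := cidx_square k zsq.
rewrite [leLHS](_ : _ =
    (lebesgue_measure (I c.1) * lebesgue_measure (I c.2))%E).
  rewrite !lI -EFinM lee_fin card_valid// -invfM -exprMn natrX.
  by rewrite -natrM.
by apply: product_measure1E; exact: mI.
Qed.

End Cells.

(** * Random exchanges *)

Section Resampling.
Variables (R : realType) (I U : finType).
Notation Pt := (I * bool)%type.
Variables (f : {set Pt} -> R) (uc : Pt -> U) (cost : U -> R) (J : {set I}).
Hypothesis cost_ge0 : forall u, 0 <= cost u.
Let Y0 : {set Pt} := [set q : Pt | (q.1 \notin J) && ~~ q.2]%SET.
Hypothesis f_cost : forall (A B : {set Pt}) q, Y0 \subset A ->
  (forall q', q' \in B -> uc q' = uc q) ->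
  `|f A - f (A :|: B)%SET| <= cost (uc q).
Variable bad : pred U.

(** One term per used cell, however many points it has, since [f_cost] lets them be added in one
    batch. By contrast [good_cost] is charged to each point separately. *)
Definition bad_cost := \sum_(u in [set uc q | q in [set: Pt]]%SET | bad u) cost u.
Definition good_cost (q : Pt) := if bad (uc q) then 0 else cost (uc q).

Definition restrict_choice (s : {ffun I -> bool}) : {ffun I -> bool} :=
  [ffun i => (i \in J) && s i].
Definition choice_set (s : {ffun I -> bool}) : {set Pt} :=
  [set q : Pt | q.2 == s q.1]%SET.
(** Points with index outside [J] are kept even if bad, so that the set contains [Y0] and [f_cost]
    applies to it. *)
Definition good_set (s : {ffun I -> bool}) : {set Pt} :=
  [set q in choice_set s | (q.1 \notin J) || ~~ bad (uc q)]%SET.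

(** The points of [B] are added one used cell at a time; every intermediate set still contains
    [Y0]. *)
Lemma f_add_many (A B : {set Pt}) : Y0 \subset A ->
  `|f A - f (A :|: B)%SET| <= \sum_(u in [set uc q | q in B]%SET) cost u.
Proof.
move=> YA; pose Br (r : seq U) := [set q in B | uc q \in r]%SET.
have H r : uniq r -> {subset r <= [set uc q | q in B]%SET} ->
    `|f A - f (A :|: Br r)%SET| <= \sum_(u <- r) cost u.
  elim: r => [_ _|u r IH /= /andP[ur uniqr] sub].
    rewrite big_nil (_ : Br [::] = finset.set0).
      by rewrite finset.setU0 subrr normr0.
    by apply/setP => q; rewrite !inE andbF.
  have /imsetP[q0 q0B uq0] := sub u (mem_head _ _).
  have E : (A :|: Br (u :: r) = (A :|: Br r) :|: [set q in B | uc q == u])%SET.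
    apply/setP => q; rewrite !inE.
    by case: (q \in A); case: (q \in B); rewrite //= orbC.
  rewrite big_cons E [leRHS]addrC.
  apply: (le_trans (ler_distD (f (A :|: Br r)%SET) _ _)); apply: lerD.
    by apply: IH => // v vr; apply: sub; rewrite inE vr orbT.
  rewrite uq0; apply: f_cost.
    by apply: fintype.subset_trans YA _; exact: finset.subsetUl.
  by move=> q; rewrite inE => /andP[_ /eqP].
have := H (enum [set uc q | q in B]%SET) (enum_uniq _) _.
rewrite big_enum; have -> : Br (enum [set uc q | q in B]%SET) = B.
  apply/setP => q; rewrite inE mem_enum; case qB: (q \in B) => //=.
  by apply/imsetP; exists q.
by apply => u; rewrite mem_enum.
Qed.

Lemma Y0_good s : Y0 \subset good_set (restrict_choice s).
Proof.
apply/fintype.subsetP => -[i b]; rewrite !inE /= ffunE => /andP[iJ b0].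
by rewrite (negbTE iJ) (negbTE b0) eqxx.
Qed.

Lemma good_set_dist s :
  `|f (choice_set (restrict_choice s)) - f (good_set (restrict_choice s))| <= bad_cost.
Proof.
pose B := [set q in choice_set (restrict_choice s) | bad (uc q)]%SET.
have -> : choice_set (restrict_choice s) = (good_set (restrict_choice s) :|: B)%SET.
  apply/setP => -[i b]; rewrite !inE /=.
  by case: eqP => //=; case: (bad _); rewrite ?orbT.
rewrite distrC; apply: (le_trans (f_add_many _ (Y0_good s))).
rewrite /bad_cost big_mkcondr/= big_mkcond [leRHS]big_mkcond/=.
apply: ler_sum => u _; case: ifP => [/imsetP[q]|_].
  rewrite inE => /andP[_ bq] ->; rewrite bq imset_f ?inE//.
by case: ifP => // _; case: ifP.
Qed.

(** The two sets become equal once the missing good point of the pair [i] is added to each of them.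
    Thus a replacement is estimated by two additions, the only operation that [f_cost] controls. *)
Lemma good_set_flip i s :
  `|f (good_set (restrict_choice s)) - f (good_set (restrict_choice (flip i s)))| <=
  good_cost (i, true) + good_cost (i, false).
Proof.
have g0 q : 0 <= good_cost q by rewrite /good_cost; case: ifP.
case: (boolP (i \in J)) => iJ; last first.
  rewrite (_ : restrict_choice (flip i s) = restrict_choice s) ?subrr ?normr0 ?addr_ge0//.
  apply/ffunP => j; rewrite !ffunE; case: eqP => // ->.
  by rewrite (negbTE iJ).
pose one b : {set Pt} := [set q : Pt | (q == (i, b)) && ~~ bad (uc q)]%SET.
have step s' : `|f (good_set (restrict_choice s')) -
    f (good_set (restrict_choice s') :|: one (~~ s' i))%SET| <= good_cost (i, ~~ s' i).
  rewrite /good_cost; case: ifP => b1.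
    rewrite (_ : one _ = finset.set0) ?finset.setU0 ?subrr ?normr0//.
    by apply/setP => q; rewrite !inE; case: eqP => //= ->; rewrite b1.
  apply: f_cost; first exact: Y0_good.
  by move=> q; rewrite inE => /andP[/eqP ->].
have E : (good_set (restrict_choice s) :|: one (~~ s i) =
    good_set (restrict_choice (flip i s)) :|: one (~~ flip i s i))%SET.
  apply/setP => -[j b]; rewrite !inE /= !ffunE eqxx !xpair_eqE.
  have [->|ji] := eqVneq j i; last by rewrite !orbF.
  rewrite iJ /=; case: (bad _); rewrite ?andbF//= ?andbT.
  by case: b (s i) => -[].
apply: (le_trans (ler_distD (f (good_set (restrict_choice s) :|: one (~~ s i))%SET) _ _)).
have h1 := step s; have h2 := step (flip i s).
rewrite distrC -E in h2; move: h2; rewrite ffunE eqxx negbK => h2.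
apply: (le_trans (lerD h1 h2)).
by case: (s i); rewrite // addrC.
Qed.

(* Deleting the bad points changes the difference by at most [2 * bad_cost];
   what remains is odd under [s |-> ~~ s], so that its mean is zero. *)
Lemma resampling_tail (V t : R) : 0 < V ->
  8 * (\sum_q good_cost q ^+ 2) <= V -> 2 * bad_cost < t ->
  #|[set s : {ffun I -> bool} | t <= `|f (choice_set (restrict_choice s)) -
       f (choice_set (restrict_choice [ffun i => ~~ s i]))|]%SET|%:R <=
  2 ^+ #|I| * (2 * expR (- ((t - 2 * bad_cost) ^+ 2 / (2 * V)))).
Proof.
move=> V0 sumV Rt.
pose neg (s : {ffun I -> bool}) : {ffun I -> bool} := [ffun i => ~~ s i].
have negK : involutive neg.
  by move=> s; apply/ffunP => i; rewrite !ffunE negbK.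
have neg_flip i s : neg (flip i s) = flip i (neg s).
  by apply/ffunP => j; rewrite !ffunE; case: eqP.
pose g s := f (good_set (restrict_choice s)) - f (good_set (restrict_choice (neg s))).
have g_odd s : g (neg s) = - g s by rewrite /g negK opprB.
have g_sum : \sum_s g s = 0.
  suff : \sum_s g s = - \sum_s g s by lra.
  rewrite -sumrN [LHS](reindex_inj (h := neg)); last exact: inv_inj.
  by apply: eq_bigr.
(* Both terms of [g] move under a flip, hence the factor 2. The 8 in the hypothesis on [V] then
   comes from [4 * (x + y)^2 <= 8 * (x^2 + y^2)]. *)
pose c i := 2 * (good_cost (i, true) + good_cost (i, false)).
have g_flip i s : `|g s - g (flip i s)| <= c i.
  rewrite /g neg_flip /c.
  have h1 := good_set_flip i s; have h2 := good_set_flip i (neg s).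
  set x1 := f _ in h1 *; set x2 := f _ in h2 *.
  set x3 := f _ in h1 *; set x4 := f _ in h2 *.
  have -> : x1 - x2 - (x3 - x4) = (x1 - x3) - (x2 - x4) by lra.
  by apply: (le_trans (ler_normB _ _)); rewrite mulr2n mulrDl mul1r lerD.
have c_sum : \sum_i c i ^+ 2 <= V.
  apply: le_trans sumV.
  have -> : \sum_q good_cost q ^+ 2 =
      \sum_i (good_cost (i, true) ^+ 2 + good_cost (i, false) ^+ 2).
    rewrite (eq_bigr (fun q => good_cost (q.1, q.2) ^+ 2)); last by case.
    rewrite -(pair_bigA _ (fun i b => good_cost (i, b) ^+ 2))/=.
    by apply: eq_bigr => i _; rewrite big_bool.
  rewrite mulr_sumr; apply: ler_sum => i _; rewrite /c.
  set x := good_cost _; set y := good_cost _.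
  have : 0 <= (x - y) ^+ 2 by exact: sqr_ge0.
  nra.
have t0 : 0 < t - 2 * bad_cost by rewrite subr_gt0.
set t' := t - _ in t0 *.
have H := hypercube_tail g_flip g_sum c_sum V0 t0.
have sub : [set s : {ffun I -> bool} | t <= `|f (choice_set (restrict_choice s)) -
       f (choice_set (restrict_choice (neg s)))|]%SET \subset
    ([set s | t' <= g s] :|: [set s | t' <= g (neg s)])%SET.
  apply/fintype.subsetP => s; rewrite !inE g_odd => ts.
  have h1 := good_set_dist s; have h2 := good_set_dist (neg s).
  have : t <= `|g s| + 2 * bad_cost.
    apply: (le_trans ts); rewrite /g.
    set x1 := f _ in h1 *; set x2 := f _ in h2 *.
    set x3 := f _ in h1 *; set x4 := f _ in h2 *.
    have -> : x1 - x2 = (x3 - x4) + ((x1 - x3) - (x2 - x4)) by lra.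
    apply: (le_trans (ler_normD _ _)); rewrite lerD2l.
    by apply: (le_trans (ler_normB _ _)); rewrite mulr2n mulrDl mul1r lerD.
  rewrite -lerBlDr -/t' => le1.
  by move: le1; rewrite ler_normr.
have card_neg : #|[set s | t' <= g (neg s)]%SET| = #|[set s | t' <= g s]%SET|.
  rewrite -(card_imset (mem [set s | t' <= g s]%SET) (inv_inj negK)).
  apply: eq_card => s; rewrite inE; apply/idP/imsetP => [h|[u]].
    by exists (neg s); rewrite ?inE ?negK.
  by rewrite inE => h ->; rewrite negK.
have := leq_trans (subset_leq_card sub) (leq_card_setU _ _).
rewrite card_neg addnn -mul2n -(ler_nat R) natrM => le1.
apply: (le_trans le1); by rewrite mulrCA ler_pM2l.
Qed.

End Resampling.

(** * The cost of adding points *)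

Section LocalCost.
Variables (R : realType) (L : {fset R * R} -> R) (a K N : nat).
Hypothesis L_local : local_condition a%:R L.
Notation Pt := ('I_N * bool)%type.
Notation Cell := (cell K.+1).
Variables (p : Pt -> R * R) (J : {set 'I_N}).
Hypothesis p_unit : forall q, unit_square (p q).
Hypothesis J_proper : exists j, j \notin J.

Definition point_set (A : {set Pt}) : {fset R * R} := [fset p q | q in A]%fset.

(* The depth [i] stands for the level [K.+1 - i] of dyadic squares, whose
   squares contain about [4 ^ i] points when [4 ^ K <= N < 4 ^ K.+1]. *)
Definition level (i : 'I_K.+1) := (K.+1 - i)%N.

Lemma level_le i : (level i <= K.+1)%N.
Proof. exact: leq_subr. Qed.

Lemma level_gt0 i : (0 < level i)%N.
Proof. by rewrite subn_gt0. Qed.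

(** The requirement of the local condition on [F], imposed on the fixed points alone: index outside
    [J], first copy. *)
Definition admissible (i : 'I_K.+1) (c : Cell) : Prop :=
  forall C', dyadic_squares (level i).-1 C' ->
    within_distance ((2 : R) ^ (3 - (level i)%:Z))
      (dyadic_square (level i) c.1 c.2) C' ->
    exists2 j, j \notin J & C' (p (j, false)).

Definition admb (z : R * R) (i : 'I_K.+1) := `[< admissible i (cell_of K.+1 (level i) z) >].

Definition depth (z : R * R) : 'I_K.+1 :=
  [arg min_(i < ord_max | admb z i) nat_of_ord i]%N.

(** Makes [depth] meaningful: at level 1 the only parent square is the whole unit square, so that a
    single fixed point is enough. *)
Lemma admb_max z : admb z ord_max.
Proof.
apply/asboolP => C' [l1 [l2]].
rewrite /level /= subSnn /= !ltnS !leqn0 => -[/eqP -> /eqP -> ->] _.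
have [j jJ] := J_proper; exists j => //.
by have := p_unit (j, false); rewrite /dyadic_square /unit_square expr0 !divr1.
Qed.

Lemma depth_adm z : admb z (depth z).
Proof. by rewrite /depth; case: (fintype.arg_minnP (@nat_of_ord _) (admb_max z)). Qed.

Lemma depth_min z (i : 'I_K.+1) : admb z i -> (depth z <= i)%N.
Proof. by rewrite /depth; case: (fintype.arg_minnP (@nat_of_ord _) (admb_max z)) => j _; apply. Qed.

Definition used_cell (q : Pt) : 'I_K.+1 * Cell :=
  (depth (p q), cell_of K.+1 (level (depth (p q))) (p q)).

(** Points of both copies are counted, so that [cost] is the same for every exchange. The index
    distance [a.+1] covers the ball of radius [a%:R / 2 ^+ k] around the cell, by [nbhd_near]. *)
Definition neighbors (u : 'I_K.+1 * Cell) : {set Pt} :=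
  [set q | near_cell a.+1 u.2 (cell_of K.+1 (level u.1) (p q))]%SET.

Definition cost (u : 'I_K.+1 * Cell) : R :=
  a%:R / 2 ^+ level u.1 * #|neighbors u|%:R.

Lemma cost_ge0 u : 0 <= cost u.
Proof. by rewrite /cost mulr_ge0// divr_ge0// exprn_ge0. Qed.

(** This is the hypothesis [f_cost] of the resampling argument. The local condition is applied in
    the common used cell of the points of [B]; its requirement on [F] holds because [A] contains the
    fixed points, which make that cell admissible. *)
Lemma point_set_cost (A B : {set Pt}) q :
  [set q : Pt | (q.1 \notin J) && ~~ q.2]%SET \subset A ->
  (forall q', q' \in B -> used_cell q' = used_cell q) ->
  `|L (point_set A) - L (point_set (A :|: B)%SET)| <= cost (used_cell q).
Proof.
move=> YA hB.
set i := depth (p q); set k := level i.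
set c := cell_of K.+1 k (p q).
have kK : (k <= K.+1)%N := level_le i.
have cv := cell_of_val (p q) kK.
have -> : point_set (A :|: B)%SET = (point_set A `|` point_set B)%fset.
  apply/fsetP => z; rewrite inE; apply/imfsetP/orP => [[q' /= + ->]|].
    by rewrite !inE => /orP[?|?]; [left|right]; apply/imfsetP; exists q'.
  by move=> [] /imfsetP[q' /= qA ->]; exists q'; rewrite //= !inE qA ?orbT.
have h := @L_local k (dyadic_square k c.1 c.2) (point_set A) (point_set B)
  (level_gt0 i).
have {h} := h _ _ _ _; move/(_ _ _ _ _)/le_trans; apply.
- exists c.1, c.2; rewrite !cv; split => //; exact: cidx_lt.
- by move=> z /= /imfsetP[q' _ ->].
- move=> C' dC' wC'.
  have /asboolP/(_ C' dC' wC')[j jJ jC'] := depth_adm (p q).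
  exists (p (j, false)); split => //=; apply/imfsetP; exists (j, false) => //=.
  by apply: (fintype.subsetP YA); rewrite inE /= jJ.
- move=> z zB; have [q' q'B ->] : exists2 q', q' \in B & z = p q'.
    by move: zB => /= /imfsetP[q' /= ? ->]; exists q'.
  have e := hB _ q'B.
  have e1 : depth (p q') = i := congr1 fst e.
  have e2 : cell_of K.+1 (level (depth (p q'))) (p q') = c := congr1 snd e.
  rewrite -e2 e1 !(cell_of_val (p q') kK).
  exact/cidx_square/p_unit.
rewrite -[cost (used_cell q)]/(a%:R / 2 ^+ k * #|neighbors (i, c)|%:R).
rewrite ler_wpM2l// ler_nat.
set Fs := [fset x in _ | _]%fset.
have sub : (Fs `<=` point_set (neighbors (i, c)))%fset.
  apply/fsubsetP => z; rewrite !inE /= => /andP[zAB znb].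
  have [q' zq'] : exists q', z = p q'.
    by case/orP: zAB => /imfsetP[q' _ ->]; exists q'.
  apply/imfsetP; exists q' => //=; rewrite inE /= /near_cell.
  rewrite !(cell_of_val (p q') kK) -zq'; apply: nbhd_near.
    by rewrite zq'.
  by move: znb; rewrite inE.
apply: leq_trans (fsubset_leq_card sub) _.
apply: leq_trans (leq_imfset_card _ _ _) _; rewrite cardE.
apply: uniq_leq_size; first exact: enum_finmem_uniq.
by move=> x; rewrite enum_finmemE.
Qed.

(* The child of a used cell is not admissible, which exhibits an empty cell of
   the level of the used cell. *)
Lemma used_cell_hole q : (0 < (used_cell q).1)%N ->
  exists2 c' : Cell, c' \in valid K.+1 (level (used_cell q).1) /\
    near_cell 6 (used_cell q).2 c' &
    forall j, j \notin J -> cell_of K.+1 (level (used_cell q).1) (p (j, false)) != c'.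
Proof.
rewrite /used_cell /=; set i := depth (p q) => i0.
have iK : (i.-1 < K.+1)%N by apply: leq_ltn_trans (leq_pred _) (ltn_ord i).
have levE : level (Ordinal iK) = (level i).+1.
  by rewrite /level /=; have := ltn_ord i; lia.
have : ~~ admb (p q) (Ordinal iK).
  apply/negP => /depth_min /=; rewrite -/i; lia.
move=> /asboolPn /existsNP[C' /not_implyP[dC' /not_implyP[wC' nC']]].
move: dC'; rewrite levE /= => -[l1 [l2 [h1 h2 CE]]].
have kK : (level i <= K.+1)%N := level_le i.
have lo : (2 ^ level i <= 2 ^ K.+1)%N by rewrite leq_exp2l.
pose c' : Cell := (inord l1, inord l2).
have l1E : c'.1 = l1 :> nat.
  by rewrite inordK// prednK ?expn_gt0//; exact: leq_trans lo.
have l2E : c'.2 = l2 :> nat.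
  by rewrite inordK// prednK ?expn_gt0//; exact: leq_trans lo.
exists c'.
  split; first by rewrite inE l1E l2E h1.
  have kK1 : ((level i).+1 <= K.+1)%N by rewrite -levE; exact: level_le.
  rewrite near_cell_sym /near_cell l1E l2E !(cell_of_val (p q) kK).
  apply: within_distance_near => //.
  by move: wC'; rewrite levE CE !(cell_of_val (p q) kK1).
move=> j jJ; apply/negP => /eqP e; apply: nC'; exists j => //.
have := cell_of_val (p (j, false)) kK; rewrite CE e l1E l2E => -[-> ->].
exact: cidx_square.
Qed.

End LocalCost.

(** * Counting heavy cells *)

Section GeometricSums.
Variable R : realFieldType.
Implicit Types (x y : R) (m n l i : nat).

Lemma geometric_sum_le x m l : 2 <= x ->
  \sum_(i < m | (i <= l)%N) x ^+ i <= x ^+ l.+1.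
Proof.
move=> x2; have x0 : 0 < x by lra.
suff h : \sum_(i < m | (i <= l)%N) x ^+ i <= x ^+ (minn m l.+1).
  apply: (le_trans h); apply: ler_weXn2l; first by lra.
  exact: geq_minr.
elim: m => [|m IH]; first by rewrite big_ord0 exprn_ge0// ltW.
rewrite big_mkcond big_ord_recr -big_mkcond /=.
case: (leqP m l) => ml.
  rewrite (minn_idPl _) ?ltnS// exprS.
  have : \sum_(i < m | (i <= l)%N) x ^+ i <= x ^+ m.
    by apply: (le_trans IH); rewrite (minn_idPl _)// ltnW.
  have : 0 < x ^+ m by rewrite exprn_gt0.
  by nra.
rewrite addr0; apply: (le_trans IH).
by rewrite !(minn_idPr _)// ltnW.
Qed.

Lemma geometric_tail_le y n l0 : 0 <= y -> 2 * y <= 1 ->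
  \sum_(l < n | (l0 <= l)%N) y ^+ l <= 2 * y ^+ l0.
Proof.
move=> y0 y1.
(* The subtracted term makes the bound provable by induction on [n]. *)
suff h : \sum_(l < n | (l0 <= l)%N) y ^+ l <= 2 * y ^+ l0 - 2 * y ^+ (maxn n l0).
  by apply: (le_trans h); rewrite gerBl mulr_ge0// exprn_ge0.
elim: n => [|n IH]; first by rewrite big_ord0 max0n subrr.
rewrite big_mkcond big_ord_recr -big_mkcond /=.
case: (leqP l0 n) => ln.
  rewrite (maxn_idPl _) ?(leq_trans ln)//.
  move: IH; rewrite (maxn_idPl _)// exprS.
  have : 0 <= y ^+ n by rewrite exprn_ge0.
  by nra.
by rewrite addr0; move: IH; rewrite !(maxn_idPr _)// ltnW.
Qed.

(* The first term bounds the typical number of cells with about [4 ^ l] points;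
   the second one absorbs deviations of probability [expR (- 4 ^+ lam / C)]. *)
Definition zeta k0 lam l : R :=
  4 ^+ k0 / 4 ^+ (5 * l) + (if (l <= lam)%N then 4 ^+ lam / 4 ^+ l else 0).

Lemma zeta_ge0 k0 lam l : 0 <= zeta k0 lam l.
Proof.
apply: addr_ge0; first by rewrite divr_ge0// exprn_ge0.
by case: ifP => // _; rewrite divr_ge0// exprn_ge0.
Qed.

(** Summing over [i <= l] leaves [8^l] up to a constant. Against the first term of [zeta] this
    becomes [4^k0 / 128^l], summed from [l0], where [4^k0 <= 4^lam * 64^l0]; against the second it
    becomes [4^lam * 2^l], dominated by [l = lam]. *)
Lemma bad_sum_le k0 lam l0 (m n : nat) (Z : nat -> nat -> R) (c : R) : 0 <= c ->
  (forall i l, (i < m)%N -> (i <= l < n)%N -> Z i l <= c * zeta k0 lam l) ->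
  (k0 <= lam + 3 * l0)%N ->
  \sum_(i < m) \sum_(l < n | (i <= l)%N && (l0 <= l)%N) 2 ^+ i * 4 ^+ l * Z i l
  <= 8 * c * 8 ^+ lam.
Proof.
move=> c0 hZ hk.
apply: (@le_trans _ _ (\sum_(l < n | (l0 <= l)%N)
    2 ^+ l.+1 * 4 ^+ l * (c * zeta k0 lam l))).
  rewrite (exchange_big_dep (fun l : 'I_n => (l0 <= l)%N))/=; last first.
    by move=> i l _ /andP[].
  apply: ler_sum => l l0l.
  apply: (@le_trans _ _ (\sum_(i < m | (i <= l)%N)
      2 ^+ i * (4 ^+ l * (c * zeta k0 lam l)))).
    rewrite (eq_bigl (fun i : 'I_m => (i <= l)%N)); last first.
      by move=> i; rewrite l0l andbT.
    apply: ler_sum => i il; rewrite mulrA ler_wpM2l ?mulr_ge0 ?exprn_ge0//.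
    by apply: hZ => //; rewrite il ltn_ord.
  rewrite -mulr_suml -mulrA ler_wpM2r//.
    by rewrite !mulr_ge0 ?exprn_ge0 ?zeta_ge0.
  exact: geometric_sum_le.
apply: (@le_trans _ _ (2 * c * (4 ^+ k0 * (\sum_(l < n | (l0 <= l)%N) (128^-1) ^+ l)
    + 4 ^+ lam * (\sum_(l < n | (l <= lam)%N) 2 ^+ l)))).
  rewrite mulrDr !mulr_sumr [X in _ <= _ + X]big_mkcond/=.
  rewrite [X in _ <= X + _]big_mkcond -big_split/= [leLHS]big_mkcond/=.
  apply: ler_sum => l _; rewrite /zeta.
  have e1 : 2 ^+ l * 4 ^+ l * (4 ^+ k0 / 4 ^+ (5 * l)) =
      4 ^+ k0 * (128^-1) ^+ l :> R.
    rewrite exprM mulrCA -exprVn -!exprMn; congr (_ * _ ^+ _).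
    by rewrite -natrX; field.
  have e2 : 2 ^+ l * 4 ^+ l * (4 ^+ lam / 4 ^+ l) = 4 ^+ lam * 2 ^+ l :> R.
    by field; rewrite expf_neq0.
  have -> z : 2 ^+ l.+1 * 4 ^+ l * (c * z) = 2 * c * (2 ^+ l * 4 ^+ l * z).
    by rewrite exprS; ring.
  have c2 : 0 <= 2 * c by rewrite mulr_ge0.
  have y0 : 0 <= 4 ^+ k0 * 128^-1 ^+ l :> R.
    by rewrite mulr_ge0 ?exprn_ge0// invr_ge0.
  have x0 : 0 <= 4 ^+ lam * 2 ^+ l :> R by rewrite mulr_ge0 ?exprn_ge0.
  rewrite mulrDr e1; case: (l <= lam)%N; case: (l0 <= l)%N;
    rewrite ?e2 ?mulr0 ?addr0 ?add0r ?mulrDr//.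
  by rewrite mulr_ge0.
have g1 : \sum_(l < n | (l0 <= l)%N) 128^-1 ^+ l <= 2 * 128^-1 ^+ l0 :> R.
  by apply: geometric_tail_le; lra.
have g2 : \sum_(l < n | (l <= lam)%N) 2 ^+ l <= 2 ^+ lam.+1 :> R.
  exact: geometric_sum_le.
have h1 : 4 ^+ k0 * (2 * 128^-1 ^+ l0) <= 2 * 8 ^+ lam :> R.
  rewrite mulrCA ler_pM2l// exprVn ler_pdivrMr ?exprn_gt0//.
  apply: (@le_trans _ _ (4 ^+ (lam + 3 * l0))); first by rewrite ler_weXn2l// ler1n.
  rewrite exprD exprM; apply: ler_pM; rewrite ?exprn_ge0//.
    by rewrite lerXn2r ?nnegrE//; lra.
  by rewrite lerXn2r ?nnegrE//; lra.
have h2 : 4 ^+ lam * 2 ^+ lam.+1 = 2 * 8 ^+ lam :> R.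
  by rewrite exprS mulrCA -exprMn; congr (_ * _ ^+ _); ring.
have h3 : 4 ^+ k0 * (\sum_(l < n | (l0 <= l)%N) 128^-1 ^+ l) <= 2 * 8 ^+ lam :> R.
  by apply: le_trans h1; rewrite ler_wpM2l ?exprn_ge0.
have h4 : 4 ^+ lam * (\sum_(l < n | (l <= lam)%N) 2 ^+ l) <= 2 * 8 ^+ lam :> R.
  by rewrite -h2 ler_wpM2l ?exprn_ge0.
apply: (@le_trans _ _ (2 * c * (2 * 8 ^+ lam + 2 * 8 ^+ lam))).
  by rewrite ler_wpM2l ?mulr_ge0// lerD.
by rewrite le_eqVlt; apply/orP; left; apply/eqP; ring.
Qed.

(** Summing over [i <= l] leaves [256^l] up to a constant. The first term of [zeta] turns it into
    [4^k0 / 4^l], which is summable; the second into [4^lam * 64^l], dominated by [l = l0 - 1]. The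
    constant is [264 = 4 * (2 + 64)]. *)
Lemma good_sum_le k0 lam l0 (m n : nat) (Z : nat -> nat -> R) (c : R) : 0 <= c ->
  (forall i l, (i < m)%N -> (i <= l < n)%N -> Z i l <= c * zeta k0 lam l) ->
  ((0 < l0)%N -> (lam + 3 * l0.-1 <= k0)%N) ->
  \sum_(i < m) \sum_(l < n | (i <= l)%N && (l < l0)%N) 4 ^+ i * 64 ^+ l * Z i l
  <= 264 * c * 4 ^+ k0.
Proof.
move=> c0 hZ hk.
case: (posnP l0) => [l00|l00].
  rewrite big1 ?mulr_ge0 ?exprn_ge0// => i _.
  by rewrite big1// => l; rewrite l00 ltn0 andbF.
apply: (@le_trans _ _ (\sum_(l < n | (l < l0)%N)
    4 ^+ l.+1 * 64 ^+ l * (c * zeta k0 lam l))).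
  rewrite (exchange_big_dep (fun l : 'I_n => (l < l0)%N))/=; last first.
    by move=> i l _ /andP[].
  apply: ler_sum => l l0l.
  apply: (@le_trans _ _ (\sum_(i < m | (i <= l)%N)
      4 ^+ i * (64 ^+ l * (c * zeta k0 lam l)))).
    rewrite (eq_bigl (fun i : 'I_m => (i <= l)%N)); last first.
      by move=> i; rewrite l0l andbT.
    apply: ler_sum => i il; rewrite mulrA ler_wpM2l ?mulr_ge0 ?exprn_ge0//.
    by apply: hZ => //; rewrite il ltn_ord.
  rewrite -mulr_suml -mulrA ler_wpM2r//.
    by rewrite !mulr_ge0 ?exprn_ge0 ?zeta_ge0.
  by apply: geometric_sum_le; lra.
apply: (@le_trans _ _ (4 * c * (4 ^+ k0 * (\sum_(l < n | (0 <= l)%N) (4^-1) ^+ l)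
    + 4 ^+ lam * (\sum_(l < n | (l <= l0.-1)%N) 64 ^+ l)))).
  rewrite mulrDr !mulr_sumr [X in _ <= _ + X]big_mkcond/=.
  rewrite -big_split/= [leLHS]big_mkcond/=.
  apply: ler_sum => l _; rewrite /zeta.
  have e1 : 4 ^+ l * 64 ^+ l * (4 ^+ k0 / 4 ^+ (5 * l)) =
      4 ^+ k0 * (4^-1) ^+ l :> R.
    rewrite exprM mulrCA -exprVn -!exprMn; congr (_ * _ ^+ _).
    by rewrite -natrX; field.
  have e2 : 4 ^+ l * 64 ^+ l * (4 ^+ lam / 4 ^+ l) = 4 ^+ lam * 64 ^+ l :> R.
    by field; rewrite expf_neq0.
  have -> z : 4 ^+ l.+1 * 64 ^+ l * (c * z) = 4 * c * (4 ^+ l * 64 ^+ l * z).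
    by rewrite exprS; ring.
  have c2 : 0 <= 4 * c by rewrite mulr_ge0.
  have y0 : 0 <= 4 ^+ k0 * 4^-1 ^+ l :> R.
    by rewrite mulr_ge0 ?exprn_ge0// invr_ge0.
  have x0 : 0 <= 4 ^+ lam * 64 ^+ l :> R by rewrite mulr_ge0 ?exprn_ge0.
  have -> : (l <= l0.-1)%N = (l < l0)%N by rewrite -ltnS prednK.
  rewrite mulrDr e1; case: (l <= lam)%N; case: (l < l0)%N;
    rewrite ?e2 ?mulr0 ?addr0 ?add0r ?mulrDr//.
  - by rewrite mulr_ge0.
  - by rewrite lerDl mulr_ge0.
  - by rewrite mulr_ge0.
have g1 : \sum_(l < n | (0 <= l)%N) 4^-1 ^+ l <= 2 * 4^-1 ^+ 0 :> R.
  by apply: geometric_tail_le; lra.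
have g2 : \sum_(l < n | (l <= l0.-1)%N) 64 ^+ l <= 64 ^+ l0.-1.+1 :> R.
  by apply: geometric_sum_le; lra.
have h3 : 4 ^+ k0 * (\sum_(l < n | (0 <= l)%N) 4^-1 ^+ l) <= 2 * 4 ^+ k0 :> R.
  by rewrite mulrC ler_wpM2r ?exprn_ge0//; move: g1; rewrite expr0 mulr1.
have h4 : 4 ^+ lam * (\sum_(l < n | (l <= l0.-1)%N) 64 ^+ l) <= 64 * 4 ^+ k0 :> R.
  apply: (@le_trans _ _ (4 ^+ lam * 64 ^+ l0.-1.+1)).
    by rewrite ler_wpM2l ?exprn_ge0.
  rewrite exprS mulrCA ler_pM2l//.
  have -> : 64 ^+ l0.-1 = 4 ^+ (3 * l0.-1) :> R.
    by rewrite exprM; congr (_ ^+ _); ring.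
  by rewrite -exprD ler_weXn2l ?ler1n ?hk.
apply: (@le_trans _ _ (4 * c * (2 * 4 ^+ k0 + 64 * 4 ^+ k0))).
  by rewrite ler_wpM2l ?mulr_ge0// lerD.
by rewrite le_eqVlt; apply/orP; left; apply/eqP; ring.
Qed.

End GeometricSums.

(** * Cost bounds for a regular configuration *)

Section Regular.
Variables (R : realType) (L : {fset R * R} -> R) (a K N : nat).
Hypothesis L_local : local_condition a%:R L.
Notation Pt := ('I_N * bool)%type.
Notation Cell := (cell K.+1).
Variables (p : Pt -> R * R) (J : {set 'I_N}).
Hypothesis p_unit : forall q, unit_square (p q).
Hypothesis J_proper : exists j, j \notin J.
Hypothesis N_lt : (N < 4 ^ K.+1)%N.

Definition cell_count (i : 'I_K.+1) (c : Cell) :=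
  #|[set q | cell_of K.+1 (level i) (p q) == c]%SET|.

Definition overfull (i : 'I_K.+1) (m : nat) :=
  #|[set c in valid K.+1 (level i) | (m <= cell_count i c)%N]%SET|.

Definition hole (i : 'I_K.+1) (c : Cell) :=
  [forall (j | j \notin J), cell_of K.+1 (level i) (p (j, false)) != c].

Definition holes (i : 'I_K.+1) :=
  #|[set c in valid K.+1 (level i) | hole i c]%SET|.

Variables (lam l0 : nat) (c0 : R).
Hypothesis c0_ge0 : 0 <= c0.

(** The typical behaviour of the sample on which the cost bounds rest. Holes are counted from depth
    1 on, since a used cell of depth 0 has no child that could fail to be admissible. *)
Definition regular :=
  (forall (i : 'I_K.+1) l, (i <= l)%N -> (l < K.+2)%N ->
     (overfull i (16 * 4 ^ l))%:R <= c0 * zeta R K.+1 lam l) /\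
  (forall i : 'I_K.+1, (0 < i)%N -> (holes i)%:R <= c0 * zeta R K.+1 lam i).

Hypothesis p_regular : regular.

(* Every used cell of depth [i] is heavy for [l = i], whatever its number of
   points: [cell_size] below is then the largest [l] for which it is heavy. *)
Definition heavy (i : 'I_K.+1) (l : nat) (c : Cell) : bool :=
  [exists c' : Cell, near_cell a.+1 c c' && (16 * 4 ^ l <= cell_count i c')%N] ||
  ((l == i :> nat) && ((i == 0 :> nat) ||
   [exists c' : Cell, near_cell 6 c c' &&
      ((c' \in valid K.+1 (level i)) && hole i c')])).

Definition heavies (i : 'I_K.+1) (l : nat) :=
  #|[set c in valid K.+1 (level i) | heavy i l c]%SET|.

Definition neighborhood_size : nat := (2 * a.+1).+1 ^ 2.
Definition heavy_const : R := (neighborhood_size + 169)%:R * c0 + 1.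

(** Each heavy cell is close to an overfull cell, or close to a hole (169 is the number of index
    pairs within distance 6), or of depth 0. In the last case [l = 0], and all [4 ^ K.+1] cells are
    covered by the first term of [zeta]; this is the [+ 1] in [heavy_const]. *)
Lemma heavies_le (i : 'I_K.+1) l : (i <= l)%N -> (l < K.+2)%N ->
  (heavies i l)%:R <= heavy_const * zeta R K.+1 lam l.
Proof.
move=> il lK; have [h1 h2] := p_regular.
have z0 := zeta_ge0 R K.+1 lam l.
pose S1 := [set c | [exists c', near_cell a.+1 c c' && (16 * 4 ^ l <= cell_count i c')%N]]%SET.
pose S2 := [set c | [exists c', near_cell 6 c c' &&
      ((c' \in valid K.+1 (level i)) && hole i c')]]%SET.
have n1 : #|S1|%:R <= neighborhood_size%:R * (c0 * zeta R K.+1 lam l).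
  have le1 : (#|S1| <= neighborhood_size * overfull i (16 * 4 ^ l))%N.
    apply: leq_trans (card_near_ex _ _) _; rewrite leq_mul2l; apply/orP; right.
    apply: subset_leq_card; apply/fintype.subsetP => c; rewrite !inE => hc.
    rewrite hc andbT.
    have : (0 < cell_count i c)%N.
      by apply: leq_trans hc; rewrite muln_gt0 expn_gt0.
    rewrite card_gt0 => /set0Pn[q]; rewrite inE => /eqP <-.
    by have := cell_of_valid (p q) (level_le i); rewrite inE.
  apply: (@le_trans _ _ (neighborhood_size * overfull i (16 * 4 ^ l))%:R); first by rewrite ler_nat.
  by rewrite natrM ler_wpM2l// h1.
have zE : (169 <= (2 * 6).+1 ^ 2)%N by [].
have n2 : (0 < i)%N -> l = i :> nat -> #|S2|%:R <= 169%:R * (c0 * zeta R K.+1 lam l).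
  move=> i0 li.
  have le1 : (#|S2| <= 169 * holes i)%N.
    apply: leq_trans (card_near_ex _ _) _; rewrite leq_mul2l; apply/orP; right.
    apply: subset_leq_card; apply/fintype.subsetP => c; rewrite !inE => //.
  apply: (@le_trans _ _ (169 * holes i)%:R); first by rewrite ler_nat.
  by rewrite natrM ler_wpM2l// li h2.
have n3 : i = 0%N :> nat -> l = 0%N -> #|valid K.+1 (level i)|%:R <= zeta R K.+1 lam l.
  move=> i0 ->; rewrite card_valid ?level_le// natrX /level i0 subn0.
  rewrite /zeta muln0 expr0 divr1 lerDl.
  by rewrite divr1 exprn_ge0.
have cz : 0 <= c0 * zeta R K.+1 lam l by rewrite mulr_ge0.
have -> : heavy_const * zeta R K.+1 lam l = neighborhood_size%:R * (c0 * zeta R K.+1 lam l) +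
    169%:R * (c0 * zeta R K.+1 lam l) + zeta R K.+1 lam l.
  by rewrite /heavy_const natrD; ring.
case: (eqVneq l (i : nat)) => li; last first.
  apply: (@le_trans _ _ #|S1|%:R).
    rewrite ler_nat; apply: subset_leq_card; apply/fintype.subsetP => c.
    by rewrite !inE /heavy (negbTE li) andFb orbF => /andP[].
  apply: (le_trans n1); rewrite -addrA lerDl addr_ge0// mulr_ge0//.
case: (posnP (i : nat)) => i0.
  apply: (@le_trans _ _ #|valid K.+1 (level i)|%:R).
    rewrite ler_nat; apply: subset_leq_card; apply/fintype.subsetP => c.
    by rewrite inE => /andP[].
  apply: (le_trans (n3 i0 _)); first by rewrite li.
  by rewrite lerDr addr_ge0// mulr_ge0.
apply: (@le_trans _ _ (#|S1| + #|S2|)%:R).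
  rewrite ler_nat; apply: leq_trans (leq_card_setU _ _).
  apply: subset_leq_card; apply/fintype.subsetP => c.
  by rewrite !inE /heavy li eqxx [_ == _]gtn_eqF //= => /andP[].
rewrite natrD; apply: (@le_trans _ _ (neighborhood_size%:R * (c0 * zeta R K.+1 lam l) +
   169%:R * (c0 * zeta R K.+1 lam l))); last by rewrite lerDl.
by apply: lerD => //; exact: n2.
Qed.

Definition cell_size (u : 'I_K.+1 * Cell) : nat :=
  \max_(l < K.+2 | (u.1 <= l)%N && heavy u.1 l u.2) l.

Notation uc := (used_cell K p J).

Lemma used_heavy q : heavy (uc q).1 (uc q).1 (uc q).2.
Proof.
rewrite /heavy eqxx /=; case: (posnP (uc q).1) => i0; first by rewrite i0 orbT.
apply/orP; right; apply/orP; right.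
have [c' [cv cn] ch] := used_cell_hole p_unit J_proper i0.
apply/existsP; exists c'; rewrite cn cv /=; apply/forallP => j; apply/implyP.
exact: ch.
Qed.

Lemma size_ge q : ((uc q).1 <= cell_size (uc q))%N.
Proof.
have lt : ((uc q).1 < K.+2)%N by apply: leq_trans (ltn_ord _) _.
apply: (@leq_bigmax_cond _ _ (fun l : 'I_K.+2 => l : nat) (Ordinal lt)).
by rewrite /= leqnn used_heavy.
Qed.

Lemma size_heavy q : heavy (uc q).1 (cell_size (uc q)) (uc q).2 /\
  (cell_size (uc q) < K.+2)%N.
Proof.
have lt : ((uc q).1 < K.+2)%N by apply: leq_trans (ltn_ord _) _.
have [|l /andP[_ hl] e] := @eq_bigmax_cond _
  [pred l : 'I_K.+2 | ((uc q).1 <= l)%N && heavy (uc q).1 l (uc q).2]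
  (fun l : 'I_K.+2 => l : nat).
  apply/card_gt0P; exists (Ordinal lt).
  by rewrite inE /= leqnn used_heavy.
have -> : cell_size (uc q) = l by rewrite -e; exact: eq_bigl.
by split=> //; exact: ltn_ord.
Qed.

(** By maximality of the size [l], no nearby cell reaches [16 * 4 ^ l.+1 = 64 * 4 ^ l] points. At
    the end of the range, [l = K.+1], the total number [2 * N] of points is already small enough. *)
Lemma neighbors_le q :
  (#|neighbors a p (uc q)| <= neighborhood_size * (64 * 4 ^ cell_size (uc q)))%N.
Proof.
set u := uc q; set l := cell_size u.
have hc c' : near_cell a.+1 u.2 c' -> (cell_count u.1 c' <= 64 * 4 ^ l)%N.
  move=> cc'; rewrite leqNgt; apply/negP => hc.
  have [_ lK] := size_heavy q; rewrite -/u -/l in lK.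
  have hc' : (16 * 4 ^ l.+1 <= cell_count u.1 c')%N by rewrite expnS; lia.
  case: (ltnP l.+1 K.+2) => lK'.
    have : (l.+1 <= l)%N.
      apply: (@leq_bigmax_cond _ _ (fun l : 'I_K.+2 => l : nat) (Ordinal lK')).
      rewrite /= (leq_trans (size_ge q))//= /heavy.
      apply/orP; left; apply/existsP; exists c'; rewrite cc' /=.
      exact: hc'.
    by rewrite ltnn.
  have : (cell_count u.1 c' <= N * 2)%N.
    by apply: leq_trans (max_card _) _; rewrite card_prod card_ord card_bool.
  have lE : l = K.+1 by lia.
  by move: hc; rewrite lE; lia.
rewrite (_ : neighbors a p u = (\bigcup_(c' in [set c' | near_cell a.+1 u.2 c'])
   [set q | cell_of K.+1 (level u.1) (p q) == c'])%SET); last first.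
  apply/setP => q'; rewrite inE; apply/idP/finset.bigcupP => [h|[c']].
    by exists (cell_of K.+1 (level u.1) (p q')); rewrite inE.
  by rewrite !inE => h /eqP ->.
apply: (@leq_trans (\sum_(c' in [set c' | near_cell a.+1 u.2 c']%SET) 64 * 4 ^ l)).
  elim/big_rec2: _ => [|c' m A]; first by rewrite cards0.
  rewrite inE => cc' h; apply: leq_trans (leq_card_setU _ _) _.
  by rewrite leq_add// hc.
by rewrite sum_nat_const leq_mul2r card_near_cell orbT.
Qed.

Definition bad (u : 'I_K.+1 * Cell) := (l0 <= cell_size u)%N.

(** A used cell is heavy for its own size, so that the used cells of given depth and size are at
    most as many as the heavy cells. *)
Lemma sum_used_le (F : 'I_K.+1 * Cell -> R) (G : nat -> nat -> R) (Q : pred nat) :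
  (forall i l, 0 <= G i l) ->
  (forall q, Q (cell_size (uc q)) -> F (uc q) <= G (uc q).1 (cell_size (uc q))) ->
  \sum_(u in [set uc q | q in [set: Pt]]%SET | Q (cell_size u)) F u <=
  \sum_(i < K.+1) \sum_(l < K.+2 | (i <= l)%N && Q l) G i l * (heavies i l)%:R.
Proof.
move=> G0 FG.
apply: (@le_trans _ _ (\sum_(u : 'I_K.+1 * Cell) \sum_(l < K.+2 | (u.1 <= l)%N && Q l)
    G u.1 l * ((u.2 \in valid K.+1 (level u.1)) && heavy u.1 l u.2)%:R)).
  rewrite big_mkcond/=; apply: ler_sum => u _.
  have S0 : 0 <= \sum_(l < K.+2 | (u.1 <= l)%N && Q l)
      G u.1 l * ((u.2 \in valid K.+1 (level u.1)) && heavy u.1 l u.2)%:R.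
    by apply: sumr_ge0 => l _; rewrite mulr_ge0.
  case: ifP => // /andP[/imsetP[q _ uq] Qu].
  have [hl lK] := size_heavy q; rewrite -uq in hl lK.
  rewrite (bigD1 (Ordinal lK))/=; last by rewrite Qu uq size_ge.
  have -> : u.2 \in valid K.+1 (level u.1).
    by rewrite uq; apply: cell_of_valid; exact: level_le.
  rewrite hl mulr1; apply: (@le_trans _ _ (G u.1 (cell_size u))).
    by rewrite uq; apply: FG; rewrite -uq.
  by rewrite lerDl sumr_ge0// => l _; rewrite mulr_ge0.
rewrite -(pair_bigA _ (fun (i : 'I_K.+1) (c : Cell) => \sum_(l < K.+2 | (i <= l)%N && Q l)
    G i l * ((c \in valid K.+1 (level i)) && heavy i l c)%:R))/=.
apply: ler_sum => i _; rewrite exchange_big/=; apply: ler_sum => l _.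
rewrite -mulr_sumr ler_wpM2l//.
rewrite /heavies -sum1_card natr_sum big_mkcond [leRHS]big_mkcond/=.
by apply: ler_sum => c _; rewrite !inE; case: ifP.
Qed.

Lemma level_inv (i : 'I_K.+1) : (2 ^+ level i)^-1 = 2 ^+ i / 2 ^+ K.+1 :> R.
Proof.
have -> : 2 ^+ K.+1 = 2 ^+ level i * 2 ^+ i :> R.
  by rewrite -exprD /level subnK// ltnW.
by field; rewrite !expf_neq0.
Qed.

Definition neighbor_const : R := (neighborhood_size * 64)%:R.

Lemma heavy_const_ge0 : 0 <= heavy_const.
Proof. by rewrite /heavy_const addr_ge0// mulr_ge0. Qed.

Lemma cost_le q : cost a p (uc q) <=
  a%:R * neighbor_const * (2 ^+ (uc q).1 * 4 ^+ cell_size (uc q)) / 2 ^+ K.+1.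
Proof.
rewrite /cost level_inv.
have h : #|neighbors a p (uc q)|%:R <= neighbor_const * 4 ^+ cell_size (uc q).
  rewrite /neighbor_const -natrX -natrM -mulnA ler_nat; exact: neighbors_le.
apply: (le_trans (ler_wpM2l _ h)).
  by rewrite mulr_ge0// mulr_ge0 ?invr_ge0 ?exprn_ge0.
move: neighbor_const (2 ^+ _) (4 ^+ _) (2 ^- _) => c x y z.
by rewrite le_eqVlt; apply/orP; left; apply/eqP; ring.
Qed.

Lemma bad_cost_le : (K.+1 <= lam + 3 * l0)%N ->
  bad_cost uc (cost a p) bad <=
  a%:R * neighbor_const / 2 ^+ K.+1 * (8 * heavy_const * 8 ^+ lam).
Proof.
move=> hl0.
apply: (@le_trans _ _ (\sum_(i < K.+1) \sum_(l < K.+2 | (i <= l)%N && (l0 <= l)%N)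
    (a%:R * neighbor_const * (2 ^+ i * 4 ^+ l) / 2 ^+ K.+1) * (heavies i l)%:R)).
  apply: (@sum_used_le (cost a p)
    (fun i l => a%:R * neighbor_const * (2 ^+ i * 4 ^+ l) / 2 ^+ K.+1) (fun l => (l0 <= l)%N)).
    by move=> i l; rewrite !mulr_ge0 ?invr_ge0 ?exprn_ge0.
  by move=> q _; exact: cost_le.
(* The default value 0 extends the count to depths out of range, as the summation lemma is stated
   over natural numbers. *)
pose Z i l : R := if insub i is Some i' then (heavies i' l)%:R else 0.
have ZE (i : 'I_K.+1) l : Z i l = (heavies i l)%:R by rewrite /Z valK.
have hZ i l : (i < K.+1)%N -> (i <= l < K.+2)%N -> Z i l <= heavy_const * zeta R K.+1 lam l.
  move=> iK /andP[il lK]; rewrite -[i]/(nat_of_ord (Ordinal iK)) ZE.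
  exact: heavies_le.
have h := bad_sum_le heavy_const_ge0 hZ hl0.
have w0 : 0 <= a%:R * neighbor_const / 2 ^+ K.+1 :> R.
  by rewrite divr_ge0 ?exprn_ge0// mulr_ge0.
apply: le_trans (ler_wpM2l w0 h).
rewrite le_eqVlt; apply/orP; left; apply/eqP; rewrite mulr_sumr.
apply: eq_bigr => i _; rewrite mulr_sumr; apply: eq_bigr => l _.
rewrite ZE; move: neighbor_const (2 ^+ _) (4 ^+ _) (2 ^- _) (heavies _ _)%:R => c x y z w.
by ring.
Qed.

(** Grouped by used cells, each squared cost is multiplied by the number of points of the cell,
    which is at most its number of neighbors. With [cost_le] this gives
    [(2^i 4^l)^2 * 4^l = 4^i * 64^l] over [4 ^+ K.+1], and the third power of [neighbor_const]. *)
Lemma good_cost_le : ((0 < l0)%N -> (lam + 3 * l0.-1 <= K.+1)%N) ->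
  \sum_q good_cost uc (cost a p) bad q ^+ 2 <= a%:R ^+ 2 * neighbor_const ^+ 3 * (264 * heavy_const).
Proof.
move=> hl0.
have -> : \sum_q good_cost uc (cost a p) bad q ^+ 2 =
    \sum_(u in [set uc q | q in [set: Pt]]%SET | (cell_size u < l0)%N)
      cost a p u ^+ 2 * #|[set q | uc q == u]%SET|%:R.
  rewrite (partition_big uc (mem [set uc q | q in [set: Pt]]%SET))/=; last first.
    by move=> q _; rewrite imset_f ?inE.
  rewrite [RHS]big_mkcondr/=; apply: eq_bigr => u _.
  rewrite (eq_bigr (fun=> if (cell_size u < l0)%N then cost a p u ^+ 2 else 0)).
    rewrite sumr_const -[X in _ *+ X]cardsE; case: ifP => _.
      by rewrite mulr_natr.
    by rewrite mul0rn.
  move=> q /eqP <-; rewrite /good_cost /bad ltnNge; case: ifP => //= _.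
  by rewrite expr0n.
apply: (@le_trans _ _ (\sum_(i < K.+1) \sum_(l < K.+2 | (i <= l)%N && (l < l0)%N)
    (a%:R ^+ 2 * neighbor_const ^+ 3 / 4 ^+ K.+1 * (4 ^+ i * 64 ^+ l)) * (heavies i l)%:R)).
  apply: (@sum_used_le (fun u => cost a p u ^+ 2 * #|[set q | uc q == u]%SET|%:R)
    (fun i l => a%:R ^+ 2 * neighbor_const ^+ 3 / 4 ^+ K.+1 * (4 ^+ i * 64 ^+ l))
    (fun l => (l < l0)%N)).
    by move=> i l; rewrite !mulr_ge0 ?invr_ge0 ?exprn_ge0.
  move=> q _.
  have h : #|[set q' | uc q' == uc q]%SET|%:R <= neighbor_const * 4 ^+ cell_size (uc q).
    apply: (@le_trans _ _ #|neighbors a p (uc q)|%:R); last first.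
      rewrite /neighbor_const -natrX -natrM -mulnA ler_nat; exact: neighbors_le.
    rewrite ler_nat; apply: subset_leq_card; apply/fintype.subsetP => q'.
    rewrite !inE => /eqP e.
    have -> : cell_of K.+1 (level (uc q).1) (p q') = (uc q).2 by rewrite -e.
    by rewrite /near_cell /idx_near !leq_addr.
  apply: (le_trans (ler_pM _ _ (lerXn2r 2 _ _ (cost_le q)) h)).
  - by rewrite sqr_ge0.
  - by [].
  - by rewrite nnegrE cost_ge0.
  - rewrite nnegrE divr_ge0 ?exprn_ge0// !mulr_ge0 ?exprn_ge0//.
  have -> : 4 ^+ (uc q).1 = (2 ^+ (uc q).1) ^+ 2 :> R.
    by rewrite exprAC; congr (_ ^+ _); ring.
  have -> : 4 ^+ K.+1 = (2 ^+ K.+1) ^+ 2 :> R.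
    by rewrite exprAC; congr (_ ^+ _); ring.
  have -> : 64 ^+ cell_size (uc q) = (4 ^+ cell_size (uc q)) ^+ 3 :> R.
    by rewrite exprAC; congr (_ ^+ _); ring.
  have : 2 ^+ K.+1 != 0 :> R by rewrite expf_neq0.
  move: neighbor_const (2 ^+ _) (4 ^+ _) (2 ^+ _) => c x y z z0.
  by rewrite le_eqVlt; apply/orP; left; apply/eqP; field.
pose Z i l : R := if insub i is Some i' then (heavies i' l)%:R else 0.
have ZE (i : 'I_K.+1) l : Z i l = (heavies i l)%:R by rewrite /Z valK.
have hZ i l : (i < K.+1)%N -> (i <= l < K.+2)%N -> Z i l <= heavy_const * zeta R K.+1 lam l.
  move=> iK /andP[il lK]; rewrite -[i]/(nat_of_ord (Ordinal iK)) ZE.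
  exact: heavies_le.
have h := good_sum_le heavy_const_ge0 hZ hl0.
have w0 : 0 <= a%:R ^+ 2 * neighbor_const ^+ 3 / 4 ^+ K.+1 :> R.
  by rewrite divr_ge0 ?exprn_ge0// mulr_ge0 ?exprn_ge0.
apply: (@le_trans _ _ (a%:R ^+ 2 * neighbor_const ^+ 3 / 4 ^+ K.+1 * (264 * heavy_const * 4 ^+ K.+1))).
  apply: le_trans (ler_wpM2l w0 h).
  rewrite le_eqVlt; apply/orP; left; apply/eqP; rewrite mulr_sumr.
  apply: eq_bigr => i _; rewrite mulr_sumr; apply: eq_bigr => l _.
  rewrite ZE; move: neighbor_const (4 ^+ _) (64 ^+ _) (4 ^- _) (_%:R) => c x y z w.
  by ring.
have : 4 ^+ K.+1 != 0 :> R by rewrite expf_neq0.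
move: neighbor_const heavy_const (4 ^+ K.+1) => c c' z z0.
by rewrite le_eqVlt; apply/orP; left; apply/eqP; field.
Qed.

(** The 8 is the one of [resampling_tail], and the 1 gives positivity. In [bad_const], 32 is the 8
    of [bad_cost_le] times the 4 that yields [2 * bad_cost <= t / 2]. *)
Definition variance_const : R := 8 * (a%:R ^+ 2 * neighbor_const ^+ 3 * (264 * heavy_const)) + 1.
Definition bad_const : R := 32 * a%:R * neighbor_const * heavy_const.

Lemma variance_const_gt0 : 0 < variance_const.
Proof.
by rewrite /variance_const ltr_wpDl// !mulr_ge0 ?exprn_ge0 ?heavy_const_ge0.
Qed.

Lemma regular_tail (t : R) : 0 < t -> (K.+1 <= lam + 3 * l0)%N ->
  ((0 < l0)%N -> (lam + 3 * l0.-1 <= K.+1)%N) ->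
  bad_const * 8 ^+ lam / 2 ^+ K.+1 <= t ->
  #|[set s : {ffun 'I_N -> bool} |
     t <= `|L (point_set p (choice_set (restrict_choice J s))) -
            L (point_set p (choice_set (restrict_choice J [ffun i => ~~ s i])))|]%SET|%:R <=
  2 ^+ N * (2 * expR (- (t ^+ 2 / (8 * variance_const)))).
Proof.
move=> t0 h1 h2 ht.
(* Half of [t] is left for the odd function, whence the 8 in the exponent. *)
have hb : 2 * bad_cost uc (cost a p) bad <= t / 2.
  have := bad_cost_le h1; rewrite /bad_const in ht; nra.
have := @resampling_tail R 'I_N _ (fun A => L (point_set p A)) uc (cost a p) J
  (cost_ge0 a p) (fun A B q => @point_set_cost R L a K N L_local p J p_unit J_proper A B q)
  bad variance_const t variance_const_gt0 _ _.
rewrite card_ord => h; apply: (le_trans (h _ _)).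
- rewrite /variance_const; have := good_cost_le h2; lra.
- lra.
rewrite !ler_pM2l ?exprn_gt0// ler_expR lerN2.
have c50 := variance_const_gt0.
rewrite ler_pdivrMr ?mulr_gt0// mulrAC ler_pdivlMr ?mulr_gt0//.
have : (t / 2) ^+ 2 <= (t - 2 * bad_cost uc (cost a p) bad) ^+ 2.
  rewrite lerXn2r ?nnegrE; lra.
nra.
Qed.

End Regular.

(** * Occupancy of cells by independent points *)

Lemma measurable_fin_preimage d (T : measurableType d) (F : finType)
    (f : T -> F) (A : set F) :
  (forall y, measurable (f @^-1` [set y])) -> measurable (f @^-1` A).
Proof.
move=> mf.
have -> : f @^-1` A = \bigcup_(y in A) (f @^-1` [set y]).
  by apply/seteqP; split=> [x Ax|x [y Ay /= e]]; [exists (f x)|rewrite /= e].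
by apply: fin_bigcup_measurable => // y _; exact: mf.
Qed.

(** Reduces the measurability of every event on the occupation of cells to that of single cells. *)
Lemma measurable_ffun_preimage d (T : measurableType d) (I F : finType)
    (f : I -> T -> F) (A : set {ffun I -> F}) :
  (forall i y, measurable (f i @^-1` [set y])) ->
  measurable [set w | A [ffun i => f i w]].
Proof.
move=> mf; apply: (@measurable_fin_preimage _ _ _ (fun w => [ffun i => f i w])).
move=> y.
have -> : (fun w => [ffun i => f i w]) @^-1` [set y] =
    \bigcap_(i in [set: I]) (f i @^-1` [set y i]).
  apply/seteqP; split=> [w /= e i _ /=|w /= h]; first by rewrite -e ffunE.
  by apply/ffunP => i; rewrite ffunE; exact: h.
by apply: fin_bigcap_measurable => // i _; exact: mf.
Qed.

Lemma le_measure_bigsetU d (T : measurableType d) (R : realType)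
    (mu : {measure set T -> \bar R}) (I : Type) (r : seq I) (Q : pred I)
    (F : I -> set T) : (forall i, measurable (F i)) ->
  (mu (\big[setU/set0]_(i <- r | Q i) F i) <= \sum_(i <- r | Q i) mu (F i))%E.
Proof.
move=> mF; elim: r => [|i r IH]; first by rewrite !big_nil measure0.
rewrite !big_cons; case: ifP => // _.
apply: (le_trans (measureU2 _ _ _)) => //; last by rewrite leeD2l.
by apply: bigsetU_measurable.
Qed.

Section Occupancy.
Context d (T : measurableType d) (R : realType) (P : probability T R).
Context d' (S : measurableType d') (N : nat) (X : 'I_N -> {RV P >-> S}).
Hypothesis X_indep : mutually_independent X.
Variables (C : finType) (phi : S -> C) (V : {set C}).
Hypothesis mphi : forall c, measurable (phi @^-1` [set c]).
Hypothesis phiV : forall i w, phi (X i w) \in V.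
Hypothesis phiP : forall i c,
  (P (X i @^-1` (phi @^-1` [set c])) <= (#|V|%:R^-1)%:E)%E.

Let mphiX i c : measurable ((phi \o X i) @^-1` [set c]).
Proof.
rewrite comp_preimage -[Y in measurable Y]setTI.
by apply: measurable_funP.
Qed.

Let mphiXA i (A : set C) : measurable ((phi \o X i) @^-1` A).
Proof. exact: measurable_fin_preimage. Qed.

Lemma prob_cells_le i (D : {set C}) :
  (P (X i @^-1` (phi @^-1` [set` D])) <= (#|D|%:R / #|V|%:R)%:E)%E.
Proof.
have -> : X i @^-1` (phi @^-1` [set` D]) =
    \big[setU/set0]_(c in D) ((phi \o X i) @^-1` [set c]).
  apply/seteqP; split=> w /=.
    move=> wD; rewrite (bigD1 (phi (X i w)))//=; by left.
  elim/big_ind: _ => //; first by move=> A B hA hB [/hA|/hB].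
  by move=> c cD /= ->.
apply: (le_trans (le_measure_bigsetU _ _ _ _)) => //.
apply: (@le_trans _ _ (\sum_(c in D) (#|V|%:R^-1)%:E)%E).
  by apply: lee_sum => c _; exact: phiP.
by rewrite sumEFin lee_fin sumr_const mulr_natl.
Qed.

Lemma prob_notin_cells_le i (D : {set C}) : D \subset V ->
  (P (X i @^-1` (phi @^-1` (~` [set` D]))) <=
   ((#|V|%:R - #|D|%:R) / #|V|%:R)%:E)%E.
Proof.
move=> DV; rewrite -natrB ?subset_leq_card//.
have -> : (#|V| - #|D|)%N = #|V :\: D|%SET.
  by rewrite cardsD (finset.setIidPr DV).
apply: le_trans (prob_cells_le i (V :\: D)%SET).
apply: le_measure; rewrite ?inE; try exact: mphiXA.
by move=> w /= /negP wD; rewrite inE wD phiV.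
Qed.

Lemma prob_all_le (J : {set 'I_N}) (A : set C) (x : R) :
  (forall i, (P (X i @^-1` (phi @^-1` A)) <= x%:E)%E) ->
  (P (\bigcap_(i in [set` J]) (X i @^-1` (phi @^-1` A))) <= (x ^+ #|J|)%:E)%E.
Proof.
move=> Ax; rewrite (X_indep J (B := fun=> phi @^-1` A)); last first.
  by move=> _; exact: measurable_fin_preimage.
have fP i : P (X i @^-1` (phi @^-1` A)) =
    (fine (P (X i @^-1` (phi @^-1` A))))%:E.
  by rewrite fineK// fin_num_measure//; exact: mphiXA.
rewrite (eq_bigr _ (fun i _ => fP i)) prodEFin lee_fin -prodr_const.
apply: ler_prod => i _; rewrite fine_ge0//=.
by rewrite -lee_fin -fP.
Qed.

(** Union bound over the [h] cells and over [h * m] points lying in them. Treating the cells jointly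
    leaves, for each choice, the single event that all these points fall in [D], to which
    independence applies. *)
Lemma overfull_le (h m : nat) :
  (P [set w | (h <= #|[set c in V | m <= #|[set i | phi (X i w) == c]|]%SET|)%N] <=
   ('C(#|V|, h)%:R * 'C(N, h * m)%:R * (h%:R / #|V|%:R) ^+ (h * m))%:E)%E.
Proof.
pose E (D : {set C}) (J : {set 'I_N}) :=
  \bigcap_(i in [set` J]) (X i @^-1` (phi @^-1` [set` D])).
have mE D J : measurable (E D J).
  by apply: fin_bigcap_measurable => // i _; exact: mphiXA.
pose U := \big[setU/set0]_(D : {set C} | (D \subset V) && (#|D| == h))
  \big[setU/set0]_(J : {set 'I_N} | #|J| == (h * m)%N) E D J.
apply: (@le_trans _ _ (P U)).
  apply: le_measure; rewrite ?inE.
  - pose A := [set f : {ffun 'I_N -> C} |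
      (h <= #|[set c in V | m <= #|[set i | f i == c]|]%SET|)%N].
    rewrite (_ : mkset _ = [set w | A [ffun i => phi (X i w)]]).
      exact: measurable_ffun_preimage.
    apply/funext => w; rewrite /A /=; congr (is_true (leq _ _)).
    apply: eq_card => c; rewrite !inE; congr (_ && leq _ _).
    by apply: eq_card => i; rewrite !inE ffunE.
  - by apply: bigsetU_measurable => D _; apply: bigsetU_measurable.
  move=> w /=; set W := [set c in V | _]%SET => hW.
  have [D /andP[DW /eqP Dh]] : exists D : {set C}, (D \subset W) && (#|D| == h).
    have : (0 < #|[set A : {set C} | A \subset W & #|A| == h]%SET|)%N.
      by rewrite cards_draws bin_gt0.
    by rewrite card_gt0 => /set0Pn[D]; rewrite inE => ?; exists D.
  pose JD := [set i | phi (X i w) \in D]%SET.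
  have hJ : (h * m <= #|JD|)%N.
    have -> : #|JD| = (\sum_(c in D) #|[set i | phi (X i w) == c]%SET|)%N.
      rewrite -sum1_card (partition_big (fun i => phi (X i w)) (mem D))/=; last first.
        by move=> i; rewrite inE.
      apply: eq_bigr => c cD; rewrite -sum1_card; apply: eq_bigl => i.
      by rewrite !inE; case: eqP => [->|]; rewrite ?cD ?andbF.
    rewrite -Dh -sum_nat_const; apply: leq_sum => c cD.
    by have := fintype.subsetP DW c cD; rewrite inE => /andP[].
  have [J /andP[JJD /eqP Jh]] : exists J : {set 'I_N},
      (J \subset JD) && (#|J| == h * m)%N.
    have : (0 < #|[set A : {set 'I_N} | A \subset JD & #|A| == (h * m)%N]%SET|)%N.
      by rewrite cards_draws bin_gt0.
    by rewrite card_gt0 => /set0Pn[J]; rewrite inE => ?; exists J.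
  rewrite /U (bigD1 D)/=; last first.
    rewrite Dh eqxx andbT; apply: fintype.subset_trans DW _.
    by apply/fintype.subsetP => c; rewrite inE => /andP[].
  left; rewrite (bigD1 J) ?Jh//=; left => i iJ.
  by have := fintype.subsetP JJD i iJ; rewrite inE.
apply: (le_trans (le_measure_bigsetU _ _ _ _)).
  by move=> D; apply: bigsetU_measurable.
apply: (@le_trans _ _ (\sum_(D : {set C} | (D \subset V) && (#|D| == h))
   ('C(N, h * m)%:R * (h%:R / #|V|%:R) ^+ (h * m))%:E)%E).
  apply: lee_sum => D /andP[_ /eqP Dh].
  apply: (le_trans (le_measure_bigsetU _ _ _ _)) => //.
  apply: (@le_trans _ _ (\sum_(J : {set 'I_N} | #|J| == (h * m)%N)
     ((h%:R / #|V|%:R) ^+ (h * m))%:E)%E).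
    apply: lee_sum => J /eqP Jh; rewrite -[X in _ ^+ X]Jh; apply: prob_all_le => i.
    by rewrite -Dh; exact: prob_cells_le.
  rewrite sumEFin lee_fin sumr_const -[X in _ *+ X <= _]cardsE card_draws.
  by rewrite card_ord [leRHS]mulr_natl.
rewrite sumEFin lee_fin sumr_const -[X in _ *+ X <= _]cardsE cards_draws.
by rewrite -mulrA [leRHS]mulr_natl.
Qed.

(** Union bound over the [h] missed cells; for a fixed choice, the points with index in [J] avoid
    them independently. *)
Lemma empty_le (h : nat) (J : {set 'I_N}) :
  (P [set w | (h <= #|[set c in V | [forall (i | i \in J), phi (X i w) != c]]%SET|)%N]
   <= ('C(#|V|, h)%:R * ((#|V|%:R - h%:R) / #|V|%:R) ^+ #|J|)%:E)%E.
Proof.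
pose E (D : {set C}) :=
  \bigcap_(i in [set` J]) (X i @^-1` (phi @^-1` (~` [set` D]))).
have mE D : measurable (E D).
  by apply: fin_bigcap_measurable => // i _; exact: mphiXA.
pose U := \big[setU/set0]_(D : {set C} | (D \subset V) && (#|D| == h)) E D.
apply: (@le_trans _ _ (P U)).
  apply: le_measure; rewrite ?inE.
  - pose A := [set f : {ffun 'I_N -> C} |
      (h <= #|[set c in V | [forall (i | i \in J), f i != c]]%SET|)%N].
    rewrite (_ : mkset _ = [set w | A [ffun i => phi (X i w)]]).
      exact: measurable_ffun_preimage.
    apply/funext => w; rewrite /A /=; congr (is_true (leq _ _)).
    apply: eq_card => c; rewrite !inE; congr (_ && _).
    by apply: eq_forallb => i; rewrite ffunE.
  - by apply: bigsetU_measurable.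
  move=> w /=; set W := [set c in V | _]%SET => hW.
  have [D /andP[DW /eqP Dh]] : exists D : {set C}, (D \subset W) && (#|D| == h).
    have : (0 < #|[set A : {set C} | A \subset W & #|A| == h]%SET|)%N.
      by rewrite cards_draws bin_gt0.
    by rewrite card_gt0 => /set0Pn[D]; rewrite inE => ?; exists D.
  rewrite /U (bigD1 D)/=; last first.
    rewrite Dh eqxx andbT; apply: fintype.subset_trans DW _.
    by apply/fintype.subsetP => c; rewrite inE => /andP[].
  left => i iJ /= /(fintype.subsetP DW); rewrite inE => /andP[_ /forallP /(_ i)].
  by rewrite iJ eqxx.
apply: (le_trans (le_measure_bigsetU _ _ _ _)) => //.
apply: (@le_trans _ _ (\sum_(D : {set C} | (D \subset V) && (#|D| == h))
   (((#|V|%:R - h%:R) / #|V|%:R) ^+ #|J|)%:E)%E).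
  apply: lee_sum => D /andP[DV /eqP Dh].
  by apply: prob_all_le => i; rewrite -Dh; exact: prob_notin_cells_le.
rewrite sumEFin lee_fin sumr_const -[X in _ *+ X <= _]cardsE cards_draws.
by rewrite [leRHS]mulr_natl.
Qed.

End Occupancy.

(** * Invariance under exchanges *)

Section TupleLaw.
Context d (S : measurableType d) (R : realType) (n : nat).

Definition box (B : 'I_n -> set S) : set (n.-tuple S) :=
  [set x | forall i, B i (tnth x i)].

Lemma measurable_box (B : 'I_n -> set S) :
  (forall i, measurable (B i)) -> measurable (box B).
Proof.
move=> mB.
have -> : box B = \bigcap_(i in [set: 'I_n]) ((@tnth n S) ^~ i @^-1` B i).
  by apply/seteqP; split=> x h i => [_|]; exact: h.
apply: fin_bigcap_measurable => // i _.
by rewrite -[X in measurable X]setTI; apply: measurable_tnth.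
Qed.

(** The boxes are stable under intersection and generate the product sigma-algebra. *)
Lemma tuple_measure_unique (m1 m2 : {measure set (n.-tuple S) -> \bar R}) :
  (forall B, (forall i, measurable (B i)) -> m1 (box B) = m2 (box B)) ->
  (m1 setT < +oo)%E ->
  forall A, measurable A -> m1 A = m2 A.
Proof.
move=> m12 m1oo A mA.
pose G : set (set (n.-tuple S)) :=
  [set A | exists2 B : 'I_n -> set S, forall i, measurable (B i) & A = box B].
have GT : G setT.
  by exists (fun=> setT) => //; apply/seteqP; split.
apply: (measure_unique G (fun=> setT)) => //.
- apply/seteqP; split.
    apply: smallest_sub; first exact: smallest_sigma_algebra.
    elim/big_ind: _ => [//|U V hU hV|i _ C [B mB <-]].
      by rewrite subUset; split.
    apply: sub_sigma_algebra; exists (fun j => if j == i then B else setT).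
      by move=> j; case: eqP.
    apply/seteqP; split=> x /=.
      by move=> [_ Bx] j; case: eqP => // ->.
    by move=> /(_ i); rewrite eqxx.
  apply: smallest_sub; first exact: sigma_algebra_measurable.
  by move=> _ [B mB ->]; exact: measurable_box.
- move=> _ _ [B mB ->] [C mC ->]; exists (fun i => B i `&` C i).
    by move=> i; exact: measurableI.
  apply/seteqP; split=> x /=.
    by move=> [hB hC] i; split.
  by move=> h; split => i; have [] := h i.
- exact: bigcup_const.
- by move=> _ [B mB ->]; exact: m12.
Qed.

End TupleLaw.

Section Swap.
Context d (T : measurableType d) (R : realType) (P : probability T R).
Context d' (S : measurableType d') (N : nat) (X : 'I_N -> {RV P >-> S}).
Hypothesis X_indep : mutually_independent X.

(** Exchanges act on the values of the samples and need not come from a map of [T * T]; invariance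
    is therefore stated for the law of this tuple. *)
Definition swapped (s : 'I_N -> bool) (z : T * T) : (N + N).-tuple S :=
  [tuple match fintype.split j with
         | inl i => X i (if s i then z.2 else z.1)
         | inr i => X i (if s i then z.1 else z.2)
         end | j < N + N].

Lemma measurable_swapped s : measurable_fun [set: T * T] (swapped s).
Proof.
apply/measurable_fun_tnthP => j; rewrite /comp /swapped.
under eq_fun do rewrite tnth_mktuple.
case: (fintype.split j) => i; case: (s i); apply: measurableT_comp => //.
Qed.

Lemma indep_box (B : 'I_N -> set S) : (forall i, measurable (B i)) ->
  P [set w | forall i, B i (X i w)] = (\prod_i P (X i @^-1` B i))%E.
Proof.
move=> mB; have := X_indep [set: 'I_N]%SET mB.
rewrite big_mkcond; under eq_bigr do rewrite finset.in_setT.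
move=> <-; congr (P _); apply/seteqP; split=> w h i; first by move=> _; exact: h.
by apply: h; rewrite /= finset.in_setT.
Qed.

Lemma measurable_indep_box (B : 'I_N -> set S) : (forall i, measurable (B i)) ->
  measurable [set w | forall i, B i (X i w)].
Proof.
move=> mB.
have -> : [set w | forall i, B i (X i w)] =
    \bigcap_(i in [set: 'I_N]) (X i @^-1` B i).
  by apply/seteqP; split=> x h i => [_|]; exact: h.
apply: fin_bigcap_measurable => // i _.
by rewrite -[X in measurable X]setTI; apply: measurable_funP.
Qed.

(** The preimage of a box is a rectangle, and exchanging the pair [i] only moves two factors from
    one side to the other. The result does not depend on [s]. *)
Lemma swapped_box s (B : 'I_(N + N) -> set S) : (forall i, measurable (B i)) ->
  (P \x P)%E (swapped s @^-1` box B) =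
  (\prod_i (P (X i @^-1` B (lshift N i)) * P (X i @^-1` B (rshift N i))))%E.
Proof.
move=> mB.
pose B1 i := B (if s i then rshift N i else lshift N i).
pose B2 i := B (if s i then lshift N i else rshift N i).
have -> : swapped s @^-1` box B =
    [set w | forall i, B1 i (X i w)] `*` [set w | forall i, B2 i (X i w)].
  apply/seteqP; split=> -[x y] /=; rewrite /box /=.
    move=> h; split=> i; [have := h (if s i then rshift N i else lshift N i)|
      have := h (if s i then lshift N i else rshift N i)];
      rewrite tnth_mktuple /B1 /B2; case E: (s i);
      by rewrite ?(unsplitK (inl i)) ?(unsplitK (inr i)) E.
  move=> [h1 h2] j; rewrite tnth_mktuple.
  case: splitP => i ij.
    have -> : j = lshift N i by exact/val_inj.
    by have := h1 i; have := h2 i; rewrite /B1 /B2; case: (s i).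
  have -> : j = rshift N i by exact/val_inj.
  by have := h1 i; have := h2 i; rewrite /B1 /B2; case: (s i).
transitivity (P [set w | forall i, B1 i (X i w)] *
              P [set w | forall i, B2 i (X i w)])%E.
  by apply: product_measure1E; apply: measurable_indep_box => i; exact: mB.
rewrite !indep_box ?/B1 ?/B2//; try by move=> i; exact: mB.
rewrite -big_split/=; apply: eq_bigr => i _.
by case: (s i) => //; rewrite muleC.
Qed.

Lemma swapped_law s s' (E : set ((N + N).-tuple S)) : measurable E ->
  (P \x P)%E (swapped s @^-1` E) = (P \x P)%E (swapped s' @^-1` E).
Proof.
move=> mE.
have PT : (P \x P)%E setT = 1%E.
  rewrite -setXTT; transitivity (P setT * P setT)%E.
    exact: product_measure1E.
  by rewrite probability_setT mule1.
have ms s := measurable_swapped s.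
(* The pushforward is taken with its measure structure, so that uniqueness on boxes applies to
   it. *)
pose m s : {measure set ((N + N).-tuple S) -> \bar R} :=
  measure_function_pushforward__canonical__measure_function_Measure (P \x P)%E (ms s).
rewrite -[LHS]/(m s E) -[RHS]/(m s' E).
apply: tuple_measure_unique => //.
  by move=> B mB; rewrite /m/= /pushforward !swapped_box.
by rewrite /m /= /pushforward preimage_setT PT ltry.
Qed.
End Swap.

(** * Tail estimates *)

Section TailNumerics.
Variable R : realType.

Lemma ffact_le_exp (n k : nat) : (n ^_ k <= n ^ k)%N.
Proof.
elim: k n => [|k IH] n; first by rewrite ffactn0 expn0.
rewrite ffactnS expnS leq_mul2l; apply/orP; right.
by apply: leq_trans (IH _) _; case: k {IH} => // k; rewrite leq_exp2r ?leq_pred.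
Qed.

(** [k^k / k!] is a single term of the series of [expR k], and ['C(n, k) * k!] is at most [n^k]. *)
Lemma bin_le_exp (n k : nat) : (0 < k)%N ->
  'C(n, k)%:R <= (expR 1 * n%:R / k%:R) ^+ k :> R.
Proof.
move=> k0; have kR : 0 < k%:R :> R by rewrite ltr0n.
have h1 : k%:R ^+ k <= expR 1 ^+ k * k`!%:R :> R.
  have /= := @expR_ge1Dxn R k%:R k.-1 (ltW kR).
  rewrite prednK// -expRM_natl mulr1 => h.
  rewrite -ler_pdivrMr ?ltr0n ?fact_gt0//.
  by apply: le_trans h; rewrite lerDr.
have h2 : 'C(n, k)%:R * k`!%:R <= n%:R ^+ k :> R.
  by rewrite -natrM bin_ffact -natrX ler_nat ffact_le_exp.
rewrite exprMn exprVn ler_pdivlMr ?exprn_gt0// exprMn.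
apply: (le_trans (ler_wpM2l _ h1)) => //.
by rewrite mulrCA ler_wpM2l ?exprn_ge0 ?expR_ge0.
Qed.

(* [24 ^+ 5 * 5`!] comes from [x ^+ 5 / 5`! <= expR x] at [x = 4 ^+ l / 24]. *)
Definition tail_const : R := expR 1 * (24 ^+ 5 * 5`!%:R).

Lemma expR1_gt1 : 1 <= expR 1 :> R.
Proof. by have := expR_ge1Dx (1 : R); lra. Qed.

Lemma tail_const_gt0 : 0 < tail_const.
Proof. by rewrite /tail_const !mulr_gt0 ?expR_gt0 ?exprn_gt0 ?ltr0n ?fact_gt0. Qed.

Lemma tail_const_ge1 : 1 <= tail_const.
Proof.
rewrite /tail_const -[leLHS]mulr1; apply: ler_pM => //; first exact: expR1_gt1.
rewrite -[leLHS]mulr1; apply: ler_pM; rewrite ?ler1n ?fact_gt0//.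
by rewrite exprn_ege1// ler1n.
Qed.

Lemma expR_pow5 (x : R) : 0 <= x -> x ^+ 5 <= 5`!%:R * expR x.
Proof.
move=> x0; have := expR_ge1Dxn 4 x0.
rewrite -ler_pdivrMl ?ltr0n ?fact_gt0// mulrC; lra.
Qed.

(** The first term of [zeta] gives [expR 1 * q / h <= expR (4^l / 24)], so that the choice of the
    cells uses up only half of the exponent [h * 4^l / 12]. The second term gives
    [h * 4^l >= (4^lam + 4^l) / 2], which splits the other half into the two factors with 48. *)
Lemma entropy_le (k0 lam l h q : nat) : tail_const * zeta R k0 lam l < h%:R ->
  (q <= 4 ^ k0)%N ->
  (expR 1 * q%:R / h%:R) ^+ h * expR (- (h%:R * 4 ^+ l / 12)) <=
  expR (- (4 ^+ lam / 48)) * expR (- (4 ^+ l / 48)) :> R.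
Proof.
move=> hz hq.
have z0 := zeta_ge0 R k0 lam l; have tail0 := tail_const_gt0.
have h0 : 0 < h%:R :> R by apply: le_lt_trans hz; rewrite mulr_ge0// ltW.
have l4 : 0 < 4 ^+ l :> R by rewrite exprn_gt0.
have e1 : expR 1 * q%:R / h%:R <= expR (4 ^+ l / 24) :> R.
  rewrite ler_pdivrMr//.
  have h1 : expR 1 * (24 ^+ 5 * 5`!%:R) * (4 ^+ k0 / (4 ^+ l) ^+ 5) <= h%:R :> R.
    apply: le_trans (ltW hz); rewrite ler_wpM2l ?(ltW tail0)//.
    rewrite /zeta mulnC exprM lerDl; case: ifP => // _.
  have h2 : (4 ^+ l / 24) ^+ 5 <= 5`!%:R * expR (4 ^+ l / 24) :> R.
    by apply: expR_pow5; rewrite divr_ge0 ?exprn_ge0.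
  apply: le_trans (ler_wpM2l (expR_ge0 _) h1).
  move: h2; rewrite exprMn exprVn ler_pdivrMr ?exprn_gt0// => h2.
  have X0 : 0 < (4 ^+ l) ^+ 5 :> R by rewrite exprn_gt0.
  have Q0 : 0 <= 4 ^+ k0 / (4 ^+ l) ^+ 5 :> R by rewrite divr_ge0 ?exprn_ge0.
  have h3 := ler_wpM2l Q0 h2; rewrite divfK ?gt_eqF// in h3.
  have h4 : q%:R <= 4 ^+ k0 :> R by rewrite -natrX ler_nat.
  apply: (le_trans (ler_wpM2l (expR_ge0 1) (le_trans h4 h3))).
  by rewrite le_eqVlt; apply/orP; left; apply/eqP; ring.
apply: (@le_trans _ _ (expR (4 ^+ l / 24) ^+ h * expR (- (h%:R * 4 ^+ l / 12)))).
  rewrite ler_wpM2r ?expR_ge0//.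
  have e0 : 0 <= expR 1 * q%:R / h%:R :> R.
    by rewrite divr_ge0 ?mulr_ge0 ?expR_ge0.
  by rewrite lerXn2r ?nnegrE ?expR_ge0.
rewrite -expRM_natl -!expRD ler_expR.
have h1 : 1 <= h%:R :> R by rewrite ler1n -(ltr0n R).
have h2 : (4 ^+ lam + 4 ^+ l) / 2 <= h%:R * 4 ^+ l :> R.
  case: (leqP l lam) => ll.
    have h3 : 4 ^+ lam / 4 ^+ l <= h%:R :> R.
      apply: le_trans (ltW hz); apply: (@le_trans _ _ (zeta R k0 lam l)).
        by rewrite /zeta ll lerDr divr_ge0 ?exprn_ge0.
      by rewrite ler_peMl// tail_const_ge1.
    rewrite ler_pdivrMr// in h3.
    have h4 : 4 ^+ l <= 4 ^+ lam :> R by rewrite ler_weXn2l ?ler1n.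
    lra.
  have h4 : 4 ^+ lam <= 4 ^+ l :> R by rewrite ler_weXn2l ?ler1n// ltnW.
  have : 4 ^+ l <= h%:R * 4 ^+ l :> R by rewrite ler_peMl// ltW.
  lra.
lra.
Qed.

(** With [m = 8 * 4^l] points per cell, the base of the power of exponent [h * m] is at most
    [expR 1 / 8]. It is below [expR (- 12^-1)], because [expR 2^-1 <= 2] and hence [expR 1 <= 4]. *)
Lemma overfull_num (k0 lam l h q N : nat) : tail_const * zeta R k0 lam l < h%:R ->
  (q <= 4 ^ k0)%N -> (0 < q)%N -> (N <= q * 4 ^ l)%N ->
  'C(q, h)%:R * 'C(N, h * (8 * 4 ^ l))%:R * (h%:R / q%:R) ^+ (h * (8 * 4 ^ l)) <=
  expR (- (4 ^+ lam / 48)) * expR (- (4 ^+ l / 48)) :> R.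
Proof.
move=> hz hq q0 Nq.
have z0 := zeta_ge0 R k0 lam l; have tail0 := tail_const_gt0.
have h0 : 0 < h%:R :> R by apply: le_lt_trans hz; rewrite mulr_ge0// ltW.
have hN : (0 < h)%N by rewrite -(ltr0n R).
apply: le_trans (entropy_le hz hq).
set m := (8 * 4 ^ l)%N.
have m0 : (0 < m)%N by rewrite /m muln_gt0 expn_gt0.
have mR : 0 < m%:R :> R by rewrite ltr0n.
have qR : 0 < q%:R :> R by rewrite ltr0n.
have hm0 : (0 < h * m)%N by rewrite muln_gt0 hN.
rewrite -mulrA; apply: ler_pM => //.
  exact: bin_le_exp.
apply: (@le_trans _ _ ((expR 1 * N%:R / (h * m)%:R) ^+ (h * m) *
    (h%:R / q%:R) ^+ (h * m))).
  by rewrite ler_wpM2r ?exprn_ge0 ?divr_ge0// bin_le_exp.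
rewrite -exprMn.
have b1 : expR 1 * N%:R / (h * m)%:R * (h%:R / q%:R) <= expR (- 12^-1) :> R.
  have -> : expR 1 * N%:R / (h * m)%:R * (h%:R / q%:R) =
      expR 1 * (N%:R / (m%:R * q%:R)) :> R.
    by rewrite natrM; field; rewrite !gt_eqF.
  have b2 : N%:R / (m%:R * q%:R) <= 8^-1 :> R.
    rewrite ler_pdivrMr ?mulr_gt0// ler_pdivlMl// -!natrM ler_nat /m.
    by rewrite -mulnA leq_mul2l mulnC Nq.
  have b3 : expR (2^-1) <= 2 :> R.
    have h3 := expR_ge1Dx (- 2^-1 : R); rewrite expRN in h3.
    have h4 : expR 2^-1 * (expR 2^-1)^-1 = 1 :> R.
      by rewrite divff// gt_eqF// expR_gt0.
    have h5 := expR_gt0 (2^-1 : R); nra.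
  have b4 : expR 1 = expR 2^-1 * expR 2^-1 :> R.
    by rewrite -expRD; congr expR; field.
  have b5 := expR_ge1Dx (- 12^-1 : R).
  have b6 := expR_gt0 (2^-1 : R).
  apply: (le_trans (ler_wpM2l (expR_ge0 _) b2)); nra.
apply: (@le_trans _ _ (expR (- 12^-1) ^+ (h * m))).
  rewrite lerXn2r ?nnegrE ?expR_ge0// mulr_ge0 ?divr_ge0 ?mulr_ge0 ?expR_ge0//.
rewrite -expRM_natl ler_expR natrM /m natrM natrX.
have : 0 < h%:R * 4 ^+ l :> R by rewrite mulr_gt0 ?exprn_gt0.
lra.
Qed.

(** [(1 - h / q)^n <= expR (- (h * n / q))]. The 12 is the product of the 4 lost in
    [4 ^ K <= N < 4 ^ K.+1] and of the 3 lost because only the points outside of [J] are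
    available. *)
Lemma holes_num (k0 lam i h q n : nat) : tail_const * zeta R k0 lam i < h%:R ->
  (q <= 4 ^ k0)%N -> (0 < q)%N -> (q * 4 ^ i <= 12 * n)%N ->
  'C(q, h)%:R * ((q%:R - h%:R) / q%:R) ^+ n <=
  expR (- (4 ^+ lam / 48)) * expR (- (4 ^+ i / 48)) :> R.
Proof.
move=> hz hq q0 nq.
have z0 := zeta_ge0 R k0 lam i; have tail0 := tail_const_gt0.
have h0 : 0 < h%:R :> R by apply: le_lt_trans hz; rewrite mulr_ge0// ltW.
have hN : (0 < h)%N by rewrite -(ltr0n R).
have qR : 0 < q%:R :> R by rewrite ltr0n.
case: (leqP h q) => hq'; last first.
  by rewrite bin_small// mul0r mulr_ge0 ?expR_ge0.
apply: le_trans (entropy_le hz hq).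
have hqR : h%:R <= q%:R :> R by rewrite ler_nat.
have r0 : 0 <= (q%:R - h%:R) / q%:R :> R by rewrite divr_ge0// subr_ge0.
apply: ler_pM => //; first by rewrite exprn_ge0.
  exact: bin_le_exp.
apply: (@le_trans _ _ (expR (- (h%:R / q%:R)) ^+ n)).
  rewrite lerXn2r ?nnegrE ?expR_ge0//.
  by apply: le_trans (expR_ge1Dx _); rewrite mulrBl divff ?gt_eqF.
rewrite -expRM_natl ler_expR mulrN lerN2 ler_pdivrMr//.
have : (q * 4 ^ i)%:R <= (12 * n)%:R :> R by rewrite ler_nat.
rewrite !natrM natrX => nq'.
have hq0 : 0 <= h%:R / q%:R :> R by rewrite divr_ge0.
have e1 : h%:R / q%:R * (q%:R * 4 ^+ i) = h%:R * 4 ^+ i :> R.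
  by field; rewrite gt_eqF.
have := ler_wpM2l hq0 nq'; rewrite e1 => h1.
by apply: (le_trans h1); rewrite le_eqVlt; apply/orP; left; apply/eqP; ring.
Qed.

End TailNumerics.

(** * Probability that one sample is irregular *)

Section SampleTail.
Context d (T : measurableType d) (R : realType) (P : probability T R).
Variables (N K lam : nat) (X : 'I_N -> {RV P >-> (R * R)%type}) (J : {set 'I_N}).
Hypothesis X_indep : mutually_independent X.
Hypothesis X_unif : forall i, uniform_on_unit_square (X i).
Hypothesis N_lt : (N < 4 ^ K.+1)%N.
Hypothesis N_ge : (4 ^ K <= N)%N.
Hypothesis J_small : (N <= 3 * #|(~: J)%SET|)%N.

Definition sample_overfull (i : 'I_K.+1) (m : nat) (w : T) :=
  #|[set c in valid K.+1 (level i) |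
     (m <= #|[set j | cell_of K.+1 (level i) (X j w) == c]|)%N]%SET|.

Definition sample_holes (i : 'I_K.+1) (w : T) :=
  #|[set c in valid K.+1 (level i) |
     [forall (j | j \in ~: J), cell_of K.+1 (level i) (X j w) != c]]%SET|.

(** The least integer strictly above the real bound: the event supplies the strict inequality that
    [entropy_le] needs, and its complement the bound itself. *)
Definition threshold (l : nat) : nat :=
  (Num.truncn (tail_const R * zeta R K.+1 lam l)).+1.

(* Two samples are superposed in [regular], hence its threshold [16 * 4 ^ l]. *)
Definition overfull_event (i : 'I_K.+1) (l : nat) : set T :=
  [set w | (threshold l <= sample_overfull i (8 * 4 ^ l) w)%N].

Definition holes_event (i : 'I_K.+1) : set T :=
  [set w | (threshold i <= sample_holes i w)%N].

(** The hole event of depth [i] is attached to the single value [l = i], so that one double union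
    covers both kinds of event. *)
Definition bad_event : set T :=
  \big[setU/set0]_(i < K.+1) \big[setU/set0]_(l < K.+2 | (i <= l)%N)
    (overfull_event i l `|` (if l == i :> nat then holes_event i else set0)).

Let tail (l : nat) : R := expR (- (4 ^+ lam / 48)) * expR (- (4 ^+ l / 48)).

Let thresholdP l : tail_const R * zeta R K.+1 lam l < (threshold l)%:R.
Proof. exact: truncnS_gt. Qed.

Let measurable_cells (i : 'I_K.+1) j (c : cell K.+1) :
  measurable ((fun w => cell_of K.+1 (level i) (X j w)) @^-1` [set c]).
Proof.
rewrite -[Y in measurable Y]setTI.
have mX : measurable_fun [set: T] (X j) by [].
exact: (mX measurableT _ (measurable_cell_of (R := R) c (level_le i))).
Qed.

Lemma measurable_overfull_event i l : measurable (overfull_event i l).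
Proof.
pose A := [set f : {ffun 'I_N -> cell K.+1} | (threshold l <=
  #|[set c in valid K.+1 (level i) | 8 * 4 ^ l <= #|[set j | f j == c]|]%SET|)%N].
rewrite (_ : overfull_event i l =
  [set w | A [ffun j => cell_of K.+1 (level i) (X j w)]]).
  by apply: measurable_ffun_preimage => j c; exact: measurable_cells.
apply/funext => w; rewrite /overfull_event /A /sample_overfull /=.
congr (is_true (leq _ _)).
apply: eq_card => c; rewrite !inE; congr (_ && leq _ _).
by apply: eq_card => j; rewrite !inE ffunE.
Qed.

Lemma measurable_holes_event i : measurable (holes_event i).
Proof.
pose A := [set f : {ffun 'I_N -> cell K.+1} | (threshold i <=
  #|[set c in valid K.+1 (level i) | [forall (j | j \in ~: J), f j != c]]%SET|)%N].
rewrite (_ : holes_event i =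
  [set w | A [ffun j => cell_of K.+1 (level i) (X j w)]]).
  by apply: measurable_ffun_preimage => j c; exact: measurable_cells.
apply/funext => w; rewrite /holes_event /A /sample_holes /=.
congr (is_true (leq _ _)).
apply: eq_card => c; rewrite !inE; congr (_ && _).
by apply: eq_forallb => j; rewrite ffunE.
Qed.

Let measurable_step i l :
  measurable (overfull_event i l `|` (if l == i :> nat then holes_event i else set0)).
Proof.
apply: measurableU; first exact: measurable_overfull_event.
by case: ifP => // _; exact: measurable_holes_event.
Qed.

Lemma measurable_bad_event : measurable bad_event.
Proof.
by apply: bigsetU_measurable => i _; apply: bigsetU_measurable => l _.
Qed.

Let level_card (i : 'I_K.+1) : #|valid K.+1 (level i)| = (4 ^ level i)%N.
Proof. exact/card_valid/level_le. Qed.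

Let level_pow (i : 'I_K.+1) : (4 ^ level i * 4 ^ i = 4 ^ K.+1)%N.
Proof. by rewrite -expnD subnK// ltnW. Qed.

Lemma overfull_event_le (i : 'I_K.+1) l : (i <= l)%N ->
  (P (overfull_event i l) <= (tail l)%:E)%E.
Proof.
move=> il; apply: (le_trans (overfull_le (phi := @cell_of R K.+1 (level i))
  (V := valid K.+1 (level i)) X_indep _ _ (threshold l) (8 * 4 ^ l)%N)).
- by move=> c; exact: measurable_cell_of (level_le i).
- by move=> j c; exact: uniform_cell (level_le i) (X_unif j).
rewrite lee_fin level_card; apply: overfull_num (thresholdP l) _ _ _.
- by rewrite leq_exp2l// level_le.
- by rewrite expn_gt0.
apply: leq_trans (ltnW N_lt) _; rewrite -(level_pow i) leq_mul2l.
by rewrite leq_exp2l// il orbT.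
Qed.

Lemma holes_event_le (i : 'I_K.+1) : (P (holes_event i) <= (tail i)%:E)%E.
Proof.
apply: (le_trans (empty_le (phi := @cell_of R K.+1 (level i))
  (V := valid K.+1 (level i)) X_indep _ _ _ (threshold i) (~: J)%SET)).
- by move=> c; exact: measurable_cell_of (level_le i).
- by move=> j w; exact: cell_of_valid (level_le i).
- by move=> j c; exact: uniform_cell (level_le i) (X_unif j).
rewrite lee_fin level_card; apply: holes_num (thresholdP i) _ _ _.
- by rewrite leq_exp2l// level_le.
- by rewrite expn_gt0.
rewrite level_pow expnS; lia.
Qed.

(** The number of depths [i <= l] is bounded by [2^(l+1)], and [expR (- (4^l / 48))] by [48 / 4^l].
    Two events for each [(i, l)] give [192 / 2^l], whose sum is at most 384. *)
Lemma bad_event_le : (P bad_event <= (384 * expR (- (4 ^+ lam / 48)))%:E)%E.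
Proof.
have mU (i : 'I_K.+1) : measurable (\big[setU/set0]_(l < K.+2 | (i <= l)%N)
    (overfull_event i l `|` (if l == i :> nat then holes_event i else set0))).
  by apply: bigsetU_measurable.
apply: le_trans (le_measure_bigsetU _ _ _ mU) _.
apply: (@le_trans _ _ (\sum_(i < K.+1) \sum_(l < K.+2 | (i <= l)%N)
    (2 * tail l)%:E)%E).
  apply: lee_sum => i _; apply: le_trans (le_measure_bigsetU _ _ _ (fun l : 'I_K.+2 => measurable_step i l)) _.
  apply: lee_sum => l il; apply: le_trans (measureU2 _ _ _) _.
  - exact: measurable_overfull_event.
  - by case: ifP => // _; exact: measurable_holes_event.
  rewrite mulr2n mulrDl mul1r EFinD; apply: leeD; first exact: overfull_event_le.
  case: ifP => [/eqP ->|_]; first exact: holes_event_le.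
  by rewrite measure0 lee_fin mulr_ge0 ?expR_ge0.
under eq_bigr do rewrite sumEFin.
rewrite sumEFin lee_fin (exchange_big_dep predT)//=.
set x := expR (- (4 ^+ lam / 48)).
apply: (@le_trans _ _ (\sum_(l < K.+2 | (0 <= l)%N) 192 * x * (2^-1) ^+ l)).
  apply: ler_sum => l _.
  rewrite (eq_bigr (fun=> 2 * tail l)) => [|//].
  apply: (@le_trans _ _ (\sum_(i < K.+1 | (i <= l)%N) 2 ^+ i * (2 * tail l))).
    apply: ler_sum => i _; rewrite ler_peMl ?mulr_ge0 ?expR_ge0//.
    by rewrite exprn_ege1// ler1n.
  rewrite -mulr_suml.
  have h1 : \sum_(i < K.+1 | (i <= l)%N) 2 ^+ i <= 2 ^+ l.+1 :> R.
    exact: geometric_sum_le.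
  have t0 : 0 <= 2 * tail l by rewrite !mulr_ge0 ?expR_ge0.
  apply: (le_trans (ler_wpM2r t0 h1)); rewrite /tail -/x.
  have h2 : expR (- (4 ^+ l / 48)) <= 48 / 4 ^+ l :> R.
    have l0 : 0 < 4 ^+ l / 48 :> R by rewrite divr_gt0 ?exprn_gt0.
    rewrite expRN -[48 / _]invf_div lef_pV2 ?posrE ?expR_gt0//.
    by have := expR_ge1Dx (4 ^+ l / 48 : R); lra.
  have e4 : 4 ^+ l = 2 ^+ l * 2 ^+ l :> R by rewrite -exprMn; congr (_ ^+ _); ring.
  have p2 : 0 < 2 ^+ l :> R by rewrite exprn_gt0.
  apply: (@le_trans _ _ (2 ^+ l.+1 * (2 * (x * (48 / 4 ^+ l))))).
    by rewrite !ler_pM2l ?exprn_gt0 ?expR_gt0.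
  rewrite e4 exprS exprVn le_eqVlt; apply/orP; left; apply/eqP; field.
  by rewrite gt_eqF.
rewrite -mulr_sumr.
have : \sum_(l < K.+2 | (0 <= l)%N) (2^-1) ^+ l <= 2 * 2^-1 ^+ 0 :> R.
  by apply: geometric_tail_le; lra.
have : 0 < x by rewrite expR_gt0.
rewrite expr0; nra.
Qed.

Lemma not_bad_event w : ~ bad_event w ->
  (forall (i : 'I_K.+1) l, (i <= l)%N -> (l < K.+2)%N ->
     (sample_overfull i (8 * 4 ^ l) w)%:R <= tail_const R * zeta R K.+1 lam l) /\
  (forall i : 'I_K.+1, (sample_holes i w)%:R <= tail_const R * zeta R K.+1 lam i).
Proof.
move=> nb.
have hb (i : 'I_K.+1) (l : 'I_K.+2) : (i <= l)%N ->
    ~ (overfull_event i l `|` (if l == i :> nat then holes_event i else set0)) w.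
  move=> il hw; apply: nb; rewrite /bad_event (bigD1 i)//=; left.
  by rewrite (bigD1 l)//=; left.
have z0 l : 0 <= tail_const R * zeta R K.+1 lam l.
  by rewrite mulr_ge0 ?zeta_ge0// ltW// tail_const_gt0.
have hn l n : ~ (threshold l <= n)%N -> n%:R <= tail_const R * zeta R K.+1 lam l.
  move=> /negP; rewrite -ltnNge ltnS /threshold => h.
  by rewrite -truncn_ge_nat.
split=> [i l il lK|i].
  apply: hn => h; apply: (hb i (Ordinal lK) il); left; exact: h.
apply: hn => h.
have iK : (i < K.+2)%N by apply: leq_trans (ltn_ord i) _.
by apply: (hb i (Ordinal iK) (leqnn _)); right; rewrite /= eqxx.
Qed.

End SampleTail.

(** * Resampling part of the sample *)

(** The sum is the integral of the number of indices [s] with [z] in [A s]: a count valid for every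
    fixed pair of samples becomes a bound on the average over the exchanges. *)
Lemma sum_measure_le d (T : measurableType d) (R : realType)
    (mu : {measure set T -> \bar R}) (F : finType) (A : F -> set T) (B : R) :
  mu setT = 1%E -> (forall s, measurable (A s)) ->
  (forall z, #|[set s | z \in A s]%SET|%:R <= B) ->
  (\sum_s mu (A s) <= B%:E)%E.
Proof.
move=> mu1 mA AB.
have I0 s z : (0 <= (\1_(A s) z : R)%:E)%E by rewrite lee_fin.
have -> : (\sum_s mu (A s) = \int[mu]_z (\sum_s (\1_(A s) z : R)%:E))%E.
  transitivity (\sum_s \int[mu]_z (\1_(A s) z : R)%:E)%E.
    by apply: eq_bigr => s _; rewrite integral_indic// setIT.
  symmetry; apply: ge0_integral_sum => // s.
  by apply/measurable_EFinP; exact: measurable_indic.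
apply: (@le_trans _ _ (\int[mu]_z (B%:E))%E).
  apply: ge0_le_integral => //.
  - by move=> z _; apply: sume_ge0 => s _; exact: I0.
  - apply: emeasurable_sum => s.
    by apply/measurable_EFinP; exact: measurable_indic.
  move=> z _; rewrite sumEFin lee_fin; apply: le_trans (AB z).
  rewrite -sum1_card natr_sum [leRHS]big_mkcond/=.
  by apply: ler_sum => s _; rewrite indicE inE; case: ifP.
by rewrite integral_cst// mu1 mule1.
Qed.

Section RegularExt.
Variables (R : realType) (K N lam : nat) (J : {set 'I_N}) (c : R).
Notation Pt := ('I_N * bool)%type.

(* For [sigma = false] this says that regularity is a property of the cells
   only, hence measurable. *)
Lemma regular_ext (p p' : Pt -> R * R) (sigma : 'I_N -> bool) :
  (forall j, j \notin J -> sigma j = false) ->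
  (forall (i : 'I_K.+1) q, cell_of K.+1 (level i) (p' q) =
     cell_of K.+1 (level i) (p (q.1, q.2 (+) sigma q.1))) ->
  regular K p' J lam c -> regular K p J lam c.
Proof.
move=> sJ pp' [h1 h2].
pose tw (q : Pt) : Pt := (q.1, q.2 (+) sigma q.1).
have twK : involutive tw by case=> j b; rewrite /tw /= addbK.
have cE (i : 'I_K.+1) (c' : cell K.+1) : cell_count p' i c' = cell_count p i c'.
  rewrite /cell_count -(card_imset (mem [set q | cell_of K.+1 (level i) (p q) == c']%SET)
    (inv_inj twK)).
  apply: eq_card => q; rewrite inE; apply/idP/imsetP => [h|[q' + ->]].
    by exists (tw q); rewrite ?twK// inE /= -pp'.
  by rewrite inE pp' -[(_, _)]/(tw (tw q')) twK.
split=> [i l il lK|i i0].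
  have := h1 i l il lK; rewrite /overfull.
  by under eq_finset do rewrite cE.
have := h2 i i0; rewrite /holes /hole.
suff -> : [set c' in valid K.+1 (level i) |
    [forall (j | j \notin J), cell_of K.+1 (level i) (p' (j, false)) != c']]%SET =
  [set c' in valid K.+1 (level i) |
    [forall (j | j \notin J), cell_of K.+1 (level i) (p (j, false)) != c']]%SET by [].
apply/setP => c'; rewrite !inE; congr (_ && _); apply: eq_forallb => j.
by case: (boolP (j \in J)) => //= jJ; rewrite pp' /= sJ.
Qed.

End RegularExt.

Section ResampleTail.
Context d (T : measurableType d) (R : realType) (P : probability T R).
Variables (L : {fset R * R} -> R) (a N K lam l0 : nat).
Variables (X : 'I_N -> {RV P >-> (R * R)%type}) (J : {set 'I_N}).
Hypothesis L_meas : measurable_functional L.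
Hypothesis L_local : local_condition a%:R L.
Hypothesis X_indep : mutually_independent X.
Hypothesis X_unif : forall i, uniform_on_unit_square (X i).
Hypothesis N_gt0 : (0 < N)%N.
Hypothesis N_lt : (N < 4 ^ K.+1)%N.
Hypothesis N_ge : (4 ^ K <= N)%N.
Hypothesis J_small : (N <= 3 * #|(~: J)%SET|)%N.
Notation Pt := ('I_N * bool)%type.
Notation S := (R * R)%type.
Notation W := ((N + N).-tuple S).

Definition pair_point (w : W) (q : Pt) : S :=
  tnth w (if q.2 then rshift N q.1 else lshift N q.1).

Definition first_half (w : W) : N.-tuple S := [tuple pair_point w (i, false) | i < N].
Definition resampled (w : W) : N.-tuple S :=
  [tuple pair_point w (i, i \in J) | i < N].

(** The restriction to the unit square makes the event measurable, since [L] is controlled only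
    there; the samples satisfy it everywhere. *)
Definition resample_event (t : R) : set W :=
  [set w | (forall j, unit_square (tnth w j)) /\
    t <= `|on_points L (first_half w) - on_points L (resampled w)|].

Let usq : set W := box (fun=> unit_square).

Let measurable_usq : measurable usq.
Proof.
apply: measurable_box => _; apply: measurableX; exact: measurable_itv.
Qed.

Let measurable_on_points (b : 'I_N -> bool) :
  measurable_fun usq
    (fun w : W => on_points L [tuple pair_point w (i, b i) | i < N]).
Proof.
apply: (@measurable_comp _ _ _ _ _ _ (box (fun=> unit_square))
  (@on_points R L N) usq (fun w : W => [tuple pair_point w (i, b i) | i < N])).
- by apply: measurable_box => _; apply: measurableX; exact: measurable_itv.
- move=> _ [w wsq <-] i; rewrite tnth_mktuple; exact: wsq.
- exact: L_meas.
apply: measurable_funTS; apply/measurable_fun_tnthP => i.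
rewrite /comp; under eq_fun do rewrite tnth_mktuple.
exact: measurable_tnth.
Qed.

Lemma measurable_resample_event t : measurable (resample_event t).
Proof.
pose h (w : W) := `|on_points L (first_half w) - on_points L (resampled w)|.
rewrite (_ : resample_event t = usq `&` h @^-1` `[t, +oo[); last first.
  apply/seteqP; split=> w /=; rewrite in_itv/= andbT; by move=> [? ?]; split.
suff mh : measurable_fun usq h by apply: mh => //; exact: measurable_itv.
apply: (@measurable_comp _ _ _ _ _ _ setT (fun x : R => `|x|)) => //.
exact: (measurable_funB (measurable_on_points (fun=> false))
  (measurable_on_points (fun i => i \in J))).
Qed.

Notation reg w := (regular K (pair_point w) J lam (2 * tail_const R)).

(** Regularity depends on the points only through the finitely many cell indices. *)
Lemma measurable_regular : measurable [set w : W | reg w].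
Proof.
pose f (x : 'I_K.+1 * Pt) (w : W) : cell K.+1 :=
  cell_of K.+1 (level x.1) (pair_point w x.2).
pose A := [set g : {ffun 'I_K.+1 * Pt -> cell K.+1} |
  exists2 w, g = [ffun x => f x w] & reg w].
rewrite (_ : mkset _ = [set w | A [ffun x => f x w]]).
  apply: measurable_ffun_preimage => x c; rewrite /f.
  rewrite -[Y in measurable Y]setTI.
  exact: (measurable_tnth _ measurableT
    (measurable_cell_of (R := R) c (level_le x.1))).
apply/seteqP; split=> w /=; first by exists w.
move=> [w' e rw']; apply: (regular_ext (sigma := fun=> false)) rw' => // i q.
case: q => j b; rewrite /= addbF.
by have := congr1 (fun g : {ffun _ -> _} => g (i, (j, b))) e; rewrite !ffunE.
Qed.

Let sw0 : T * T -> W := swapped X (fun=> false).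

Lemma pair_point_swapped s z q : pair_point (swapped X s z) q =
  X q.1 (if q.2 (+) s q.1 then z.2 else z.1).
Proof.
case: q => i b; rewrite /pair_point /swapped tnth_mktuple /=.
case: b; rewrite ?(unsplitK (inl i)) ?(unsplitK (inr i)) /=;
  by case: (s i).
Qed.

(** A cell with [16 * 4^l] points of both samples has [8 * 4^l] points of one of them, hence the
    factor 2 before [tail_const]. Holes only concern the first sample. The probability is twice
    384. *)
Lemma not_regular_le :
  ((P \x P)%E (sw0 @^-1` (~` [set w | reg w])) <=
   (768 * expR (- (4 ^+ lam / 48)))%:E)%E.
Proof.
pose B := bad_event K lam X J.
have mB : measurable B := measurable_bad_event K lam X J.
have mB1 : measurable (B `*` [set: T]) by exact: measurableX.
have mB2 : measurable ([set: T] `*` B) by exact: measurableX.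
apply: (@le_trans _ _ ((P \x P)%E ((B `*` setT) `|` (setT `*` B)))).
  apply: le_measure; rewrite ?inE.
  - rewrite -[Y in measurable Y]setTI; apply: measurable_swapped => //.
    by apply: measurableC; exact: measurable_regular.
  - exact: measurableU.
  move=> z /= nr; apply: contrapT => /not_orP[].
  rewrite /setX /= => /not_andP nb1 /not_andP nb2.
  have nB1 : ~ B z.1 by case: nb1.
  have nB2 : ~ B z.2 by case: nb2.
  have [ov1 h1] := not_bad_event nB1.
  have [ov2 h2] := not_bad_event nB2.
  apply: nr; split=> [i l il lK|i i0].
    apply: (@le_trans _ _ (sample_overfull X i (8 * 4 ^ l) z.1 +
        sample_overfull X i (8 * 4 ^ l) z.2)%:R); last first.
      rewrite natrD -mulrA mulr2n mulrDl mul1r.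
      by apply: lerD; [exact: ov1|exact: ov2].
    rewrite ler_nat /overfull /sample_overfull.
    apply: leq_trans (leq_card_setU _ _); apply: subset_leq_card.
    apply/fintype.subsetP => c; rewrite !inE => /andP[-> /=] hc.
    set n1 := #|_|; set n2 := #|_|.
    suff : (cell_count (pair_point (sw0 z)) i c <= n1 + n2)%N.
      move=> le1; have := leq_trans hc le1; case: (leqP (8 * 4 ^ l) n1) => //=; lia.
    rewrite /cell_count.
    pose S1 := [set j | cell_of K.+1 (level i) (X j z.1) == c]%SET.
    pose S2 := [set j | cell_of K.+1 (level i) (X j z.2) == c]%SET.
    apply: (@leq_trans #|([set (j, false) | j in S1] :|: [set (j, true) | j in S2])%SET|).
      apply: subset_leq_card; apply/fintype.subsetP => -[j b].
      rewrite inE pair_point_swapped /= addbF => e.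
      rewrite inE; case: b e => e; apply/orP; [right|left];
        by apply/imsetP; exists j; rewrite ?inE.
    by apply: leq_trans (leq_card_setU _ _) _; rewrite leq_add// leq_imset_card.
  have h : (holes (pair_point (sw0 z)) J i <= sample_holes X J i z.1)%N.
    apply: subset_leq_card; apply/fintype.subsetP => c; rewrite !inE.
    move=> /andP[-> /forallP hj]; apply/forallP => j; have := hj j.
    by rewrite !inE pair_point_swapped.
  apply: (@le_trans _ _ (sample_holes X J i z.1)%:R); first by rewrite ler_nat.
  apply: (le_trans (h1 i)); rewrite -mulrA ler_peMl ?ler1n//.
  by rewrite mulr_ge0 ?zeta_ge0// ltW// tail_const_gt0.
apply: le_trans (measureU2 _ _ _) _ => //.
have e : (768 * expR (- (4 ^+ lam / 48)))%:E =
  ((384 * expR (- (4 ^+ lam / 48)))%:E + (384 * expR (- (4 ^+ lam / 48)))%:E)%E :> \bar R.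
  by rewrite -EFinD; congr (_%:E); ring.
have b := bad_event_le lam X_indep X_unif N_lt N_ge J_small.
rewrite e; apply: leeD.
  apply: (@le_trans _ _ (P B * P setT)%E); last by rewrite probability_setT mule1.
  by rewrite le_eqVlt; apply/orP; left; apply/eqP; exact: product_measure1E.
apply: (@le_trans _ _ (P setT * P B)%E); last by rewrite probability_setT mul1e.
by rewrite le_eqVlt; apply/orP; left; apply/eqP; exact: product_measure1E.
Qed.

Lemma resample_tail t : 0 < t -> (K.+1 <= lam + 3 * l0)%N ->
  ((0 < l0)%N -> (lam + 3 * l0.-1 <= K.+1)%N) ->
  bad_const a (2 * tail_const R) * 8 ^+ lam / 2 ^+ K.+1 <= t ->
  ((P \x P)%E (sw0 @^-1` resample_event t) <=
   (768 * expR (- (4 ^+ lam / 48)) +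
    2 * expR (- (t ^+ 2 / (8 * variance_const a (2 * tail_const R)))))%:E)%E.
Proof.
move=> t0 h1 h2 ht.
have PT : (P \x P)%E setT = 1%E.
  rewrite -setXTT; transitivity (P setT * P setT)%E.
    exact: product_measure1E.
  by rewrite probability_setT mule1.
pose E0 := resample_event t `&` [set w | reg w].
have mE0 : measurable E0.
  by apply: measurableI; [exact: measurable_resample_event|exact: measurable_regular].
have msw s (E : set W) : measurable E -> measurable (swapped X s @^-1` E).
  by move=> mE; rewrite -[Y in measurable Y]setTI; apply: measurable_swapped.
apply: (@le_trans _ _ ((P \x P)%E
    ((sw0 @^-1` (~` [set w | reg w])) `|` (sw0 @^-1` E0)))).
  apply: le_measure; rewrite ?inE.
  - by apply: msw; exact: measurable_resample_event.
  - apply: measurableU; apply: msw => //.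
    by apply: measurableC; exact: measurable_regular.
  by move=> z /= hz; have [?|?] := pselect (reg (sw0 z)); [right|left].
have mn : measurable (sw0 @^-1` (~` [set w | reg w])).
  by apply: msw; apply: measurableC; exact: measurable_regular.
apply: le_trans (measureU2 _ mn (msw _ _ mE0)) _.
rewrite EFinD; apply: leeD; first exact: not_regular_le.
(* All these events have the same probability. For fixed [z], [regular_tail] bounds how many of the
   [2 ^ N] exchanges put [z] in them. *)
pose A (s : {ffun 'I_N -> bool}) := swapped X (restrict_choice J s) @^-1` E0.
have PA s : (P \x P)%E (A s) = (P \x P)%E (sw0 @^-1` E0) by exact: swapped_law.
set x := (P \x P)%E (sw0 @^-1` E0) in PA *.
have J_proper : exists j, j \notin J.
  have : (0 < #|(~: J)%SET|)%N by lia.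
  by rewrite card_gt0 => /set0Pn[j]; rewrite inE => ?; exists j.
have tail0 : 0 <= 2 * tail_const R by rewrite mulr_ge0// ltW// tail_const_gt0.
set y := 2 * expR (- (t ^+ 2 / (8 * variance_const a (2 * tail_const R)))).
have Asum : (\sum_s (P \x P)%E (A s) <= (2 ^+ N * y)%:E)%E.
  apply: (sum_measure_le PT) => [s|z]; first exact: msw.
  pose p (q : Pt) := X q.1 (if q.2 then z.2 else z.1).
  have punit q : unit_square (p q) by exact: (X_unif q.1).1.
  have pE s (b : 'I_N -> bool) (b' : {ffun 'I_N -> bool}) :
      (forall i, b i (+) restrict_choice J s i = b' i) ->
      on_points L [tuple pair_point (swapped X (restrict_choice J s) z) (i, b i) | i < N]
      = L (point_set p (choice_set b')).
    move=> bb'; rewrite /on_points; congr L; apply/fsetP => u.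
    apply/imfsetP/imfsetP => [[i /= _ ->]|[[i c] /= + ->]].
      exists (i, b' i) => /=; first by rewrite inE.
      by rewrite tnth_mktuple pair_point_swapped /p /= bb'.
    rewrite inE /= => /eqP ->; exists i => //.
    by rewrite tnth_mktuple pair_point_swapped /p /= bb'.
  have [rz|nrz] := pselect (regular K p J lam (2 * tail_const R)); last first.
    rewrite (_ : [set s | _]%SET = finset.set0) ?cards0 ?mulr_ge0 ?exprn_ge0 ?expR_ge0//.
    apply/setP => s; rewrite !inE; apply/negP; rewrite inE => -[_ rs]; apply: nrz.
    (* Exchanges within [J] preserve regularity: overfull cells count both copies, and holes see the
       fixed points only. *)
    apply: (regular_ext (sigma := restrict_choice J s)) rs; last first.
      by move=> i q; rewrite pair_point_swapped.
    by move=> j jJ; rewrite ffunE (negbTE jJ).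
  apply: le_trans (regular_tail L_local punit J_proper N_lt tail0 rz t0 h1 h2 ht).
  rewrite ler_nat; apply: subset_leq_card; apply/fintype.subsetP => s.
  rewrite !inE => -[[_ ts] _]; apply: (le_trans ts).
  rewrite /first_half /resampled (pE s _ (restrict_choice J s)); last first.
    by move=> i; rewrite addFb.
  rewrite (pE s _ (restrict_choice J [ffun i => ~~ s i]))//.
  by move=> i; rewrite !ffunE; case: (i \in J) => //=; rewrite addTb.
have xfin : x \is a fin_num.
  rewrite ge0_fin_numE ?measure_ge0//; apply: (@le_lt_trans _ _ 1%E); last exact: ltry.
  rewrite -PT; apply: le_measure; rewrite ?inE//; exact: msw.
suff : (x <= y%:E)%E by [].
move: Asum; rewrite (eq_bigr (fun=> x)) => [|s _]; last exact: PA.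
rewrite -(fineK xfin) sumEFin !lee_fin sumr_const card_hypercube card_ord.
by rewrite -[leLHS]mulr_natl natrX ler_pM2l// exprn_gt0.
Qed.

End ResampleTail.

(** * Concentration around the median *)

Lemma local_condition_le (R : realType) (kappa kappa' : R) (L : {fset R * R} -> R) :
  kappa <= kappa' -> local_condition kappa L -> local_condition kappa' L.
Proof.
move=> kk' hL k C F G k1 hC hF hCF hG.
have k0 : 0 <= 2 ^- k :> R by rewrite invr_ge0 exprn_ge0.
apply: (le_trans (hL k C F G k1 hC hF hCF hG)); rewrite -!mulrA.
set n := #|` _|; set m := #|` _|.
have nm : (n <= m)%N.
  apply: fsubset_leq_card; apply/fsubsetP => x; rewrite !inE => /andP[-> /=].
  rewrite !inE => -[y Cy dxy]; exists y => //; apply: le_trans dxy _.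
  by rewrite ler_wpM2r.
apply: (@le_trans _ _ (kappa' * (2 ^- k * n%:R))).
  by rewrite ler_wpM2r// mulr_ge0.
(* For a negative constant the neighborhood is empty, and both sides vanish. *)
have [kp|kn] := leP 0 kappa'; first by rewrite ler_wpM2l// ler_wpM2l// ler_nat.
have m0 : m = 0%N.
  apply/eqP; rewrite cardfs_eq0; apply/eqP/fsetP => x; rewrite !inE.
  apply/negbTE/negP => /andP[_]; rewrite !inE => -[y _].
  have : 0 <= Defs.edist x y by exact: sqrtr_ge0.
  have : kappa' * 2 ^- k < 0 by rewrite nmulr_rlt0// invr_gt0 exprn_gt0.
  lra.
by move: nm; rewrite m0 leqn0 => /eqP ->; rewrite !mulr0.
Qed.

Section Median.
Context d (T : measurableType d) (R : realType) (P : probability T R).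

Lemma prob_half_mul (A B : set T) (C : set (T * T)) (b : R) :
  measurable A -> measurable B -> measurable C -> A `*` B `<=` C ->
  (2^-1%:E <= P B)%E -> ((P \x P)%E C <= b%:E)%E -> (P A <= (2 * b)%:E)%E.
Proof.
move=> mA mB mC AB PB PC.
have PAB : (P A * P B <= b%:E)%E.
  apply: le_trans PC; apply: (@le_trans _ _ ((P \x P)%E (A `*` B))).
    by rewrite le_eqVlt; apply/orP; left; apply/eqP; symmetry; exact: product_measure1E.
  by apply: le_measure; rewrite ?inE//; exact: measurableX.
have fA : P A = (fine (P A))%:E by rewrite fineK// fin_num_measure.
have fB : P B = (fine (P B))%:E by rewrite fineK// fin_num_measure.
have A0 : 0 <= fine (P A) by rewrite fine_ge0.
move: PAB PB; rewrite fA fB -EFinM !lee_fin; nra.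
Qed.

(** A large value at one copy together with a value on the other side of the median at an
    independent copy makes a gap of at least [t]. Each of the two tails costs a factor 2 by
    [prob_half_mul]. *)
Lemma median_gap (Y : T -> R) (M t b : R) : measurable_fun setT Y ->
  is_median P Y M -> 0 < t ->
  ((P \x P)%E [set z | (t <= `|Y z.1 - Y z.2|)%R] <= b%:E)%E ->
  (P [set w | (t <= `|Y w - M|)%R] <= (4 * b)%:E)%E.
Proof.
move=> mY [M1 M2] t0 hb.
have mge (x : R) : measurable [set w | x <= Y w].
  rewrite (_ : mkset _ = Y @^-1` `[x, +oo[).
    by rewrite -[X in measurable X]setTI; apply: mY => //; exact: measurable_itv.
  by apply/seteqP; split=> w /=; rewrite in_itv/= andbT.
have mle (x : R) : measurable [set w | Y w <= x].
  rewrite (_ : mkset _ = Y @^-1` `]-oo, x]).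
    by rewrite -[X in measurable X]setTI; apply: mY => //; exact: measurable_itv.
  by apply/seteqP; split=> w /=; rewrite in_itv/=.
have mC : measurable [set z : T * T | t <= `|Y z.1 - Y z.2|].
  have mh : measurable_fun setT (fun z : T * T => `|Y z.1 - Y z.2|).
    apply: measurableT_comp => //; apply: measurable_funB; exact: measurableT_comp.
  rewrite (_ : mkset _ = (fun z : T * T => `|Y z.1 - Y z.2|) @^-1` `[t, +oo[).
    by rewrite -[X in measurable X]setTI; apply: mh => //; exact: measurable_itv.
  by apply/seteqP; split=> w /=; rewrite in_itv/= andbT.
have b1 : (P [set w | (M + t <= Y w)%R] <= (2 * b)%:E)%E.
  apply: prob_half_mul (mge _) (mle M) mC _ M1 hb.
  by move=> [x y] [/= h1 h2]; rewrite ler_normr; apply/orP; left; lra.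
have b2 : (P [set w | (Y w <= M - t)%R] <= (2 * b)%:E)%E.
  apply: prob_half_mul (mle _) (mge M) mC _ M2 hb.
  by move=> [x y] [/= h1 h2]; rewrite ler_normr; apply/orP; right; lra.
apply: (@le_trans _ _ (P ([set w | (M + t <= Y w)%R] `|` [set w | (Y w <= M - t)%R]))).
  apply: le_measure; rewrite ?inE.
  - have mh : measurable_fun setT (fun w => `|Y w - M|).
      by apply: measurableT_comp => //; exact: measurable_funB.
    rewrite (_ : mkset _ = (fun w => `|Y w - M|) @^-1` `[t, +oo[).
      by rewrite -[X in measurable X]setTI; apply: mh => //; exact: measurable_itv.
    by apply/seteqP; split=> w /=; rewrite in_itv/= andbT.
  - by apply: measurableU.
  by move=> w /=; rewrite ler_normr => /orP[h|h]; [left|right]; rewrite /=; lra.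
apply: le_trans (measureU2 _ (mge _) (mle _)) _.
have -> : (4 * b)%:E = ((2 * b)%:E + (2 * b)%:E)%E.
  by rewrite -EFinD; congr (_%:E); ring.
exact: leeD.
Qed.

End Median.

Section Gap.
Context d (T : measurableType d) (R : realType) (P : probability T R).
Variables (L : {fset R * R} -> R) (a N K lam l0 : nat).
Variables (X : 'I_N -> {RV P >-> (R * R)%type}).
Hypothesis L_meas : measurable_functional L.
Hypothesis L_local : local_condition a%:R L.
Hypothesis X_indep : mutually_independent X.
Hypothesis X_unif : forall i, uniform_on_unit_square (X i).
Hypothesis N_gt1 : (1 < N)%N.
Hypothesis N_lt : (N < 4 ^ K.+1)%N.
Hypothesis N_ge : (4 ^ K <= N)%N.

Let LN := fun w : T => on_points L [tuple X i w | i < N].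

Lemma measurable_LN : measurable_fun setT LN.
Proof.
apply: (@measurable_comp _ _ _ _ _ _ (box (fun=> unit_square))
  (@on_points R L N) setT (fun w : T => [tuple X i w | i < N])).
- by apply: measurable_box => _; apply: measurableX; exact: measurable_itv.
- by move=> _ [w _ <-] i; rewrite tnth_mktuple; exact: (X_unif i).1.
- exact: L_meas.
apply/measurable_fun_tnthP => i.
rewrite (_ : _ \o _ = X i)//.
by apply/funext => w; rewrite /= tnth_mktuple.
Qed.

Lemma gap_tail (t : R) : 0 < t -> (K.+1 <= lam + 3 * l0)%N ->
  ((0 < l0)%N -> (lam + 3 * l0.-1 <= K.+1)%N) ->
  bad_const a (2 * tail_const R) * 8 ^+ lam / 2 ^+ K.+1 <= t / 2 ->
  ((P \x P)%E [set z | (t <= `|LN z.1 - LN z.2|)%R] <=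
   (2 * (768 * expR (- (4 ^+ lam / 48)) +
    2 * expR (- ((t / 2) ^+ 2 / (8 * variance_const a (2 * tail_const R))))))%:E)%E.
Proof.
move=> t0 h1 h2 ht.
(* Since [N > 1], this set and its complement both have at least a third of the indices, as the
   bound on holes requires. *)
pose J := [set i : 'I_N | (i < N./2)%N]%SET.
have cJ : #|J| = N./2.
  have le : (N./2 <= N)%N by rewrite -[leqRHS]odd_double_half -addnn; lia.
  have winj : injective (widen_ord le).
    by move=> x y /(congr1 val) /= xy; exact/val_inj.
  rewrite -[RHS]card_ord -cardsT -(card_imset _ winj).
  apply: eq_card => x; rewrite inE; apply/idP/imsetP => [ak|[b _ ->]].
    by exists (Ordinal ak) => //; exact/val_inj.
  exact: (ltn_ord b).
have sJ : (N <= 3 * #|(~: J)%SET|)%N.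
  by rewrite cardsCs finset.setCK cJ card_ord; lia.
have sJ' : (N <= 3 * #|(~: ~: J)%SET|)%N by rewrite finset.setCK cJ; lia.
have t20 : 0 < t / 2 by rewrite divr_gt0.
have N0 : (0 < N)%N by exact: ltnW.
have B1 := resample_tail L_meas L_local X_indep X_unif N0 N_lt N_ge sJ t20 h1 h2 ht.
have B2 := resample_tail L_meas L_local X_indep X_unif N0 N_lt N_ge sJ' t20 h1 h2 ht.
have mE (J' : {set 'I_N}) := measurable_resample_event J' L_meas (t / 2).
(* With all pairs exchanged, the second step starts from [z.2] and resamples the complement of [J],
   so that it ends at the same [mid] as the first one. *)
rewrite (swapped_law X_indep _ (fun=> true) (mE _)) in B2.
have mS s (J' : {set 'I_N}) : measurable (swapped X s @^-1` resample_event L J' (t / 2)).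
  by rewrite -[Y in measurable Y]setTI; apply: measurable_swapped.
have FH s z : first_half (swapped X s z) = [tuple X i (if s i then z.2 else z.1) | i < N].
  by apply: eq_from_tnth => i; rewrite !tnth_mktuple pair_point_swapped addFb.
have RS (J' : {set 'I_N}) s z : resampled J' (swapped X s z) =
    [tuple X i (if (i \in J') (+) s i then z.2 else z.1) | i < N].
  by apply: eq_from_tnth => i; rewrite !tnth_mktuple pair_point_swapped.
apply: (@le_trans _ _ ((P \x P)%E
   ((swapped X (fun=> false) @^-1` resample_event L J (t / 2)) `|`
    (swapped X (fun=> true) @^-1` resample_event L (~: J)%SET (t / 2))))).
  apply: le_measure; rewrite ?inE.
  - have mh : measurable_fun setT (fun z : T * T => `|LN z.1 - LN z.2|).
      apply: measurableT_comp => //; apply: measurable_funB;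
        exact: measurableT_comp measurable_LN _.
    rewrite (_ : mkset _ = (fun z : T * T => `|LN z.1 - LN z.2|) @^-1` `[t, +oo[).
      by rewrite -[Y in measurable Y]setTI; apply: mh => //; exact: measurable_itv.
    by apply/seteqP; split=> w /=; rewrite in_itv/= andbT.
  - exact: measurableU.
  move=> z /= tz.
  have usq s j : unit_square (tnth (swapped X s z) j).
    by rewrite tnth_mktuple; case: (fintype.split j) => i; exact: (X_unif i).1.
  pose mid := on_points L [tuple X i (if i \in J then z.2 else z.1) | i < N].
  have : (t / 2 <= `|LN z.1 - mid|) || (t / 2 <= `|LN z.2 - mid|).
    rewrite -[_ || _]negbK negb_or -!ltNge; apply/negP => /andP[k1 k2].
    have := ler_distD mid (LN z.1) (LN z.2); rewrite (distrC mid); lra.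
  move=> /orP[k1|k1]; [left|right]; split => //; rewrite FH RS.
    rewrite (_ : [tuple X i (if (i \in J) (+) false then z.2 else z.1) | i < N] =
      [tuple X i (if i \in J then z.2 else z.1) | i < N])//.
    by apply: eq_from_tnth => i; rewrite !tnth_mktuple addbF.
  rewrite (_ : [tuple X i (if (i \in (~: J)%SET) (+) true then z.2 else z.1) | i < N] =
      [tuple X i (if i \in J then z.2 else z.1) | i < N])//.
  by apply: eq_from_tnth => i; rewrite !tnth_mktuple finset.in_setC addbT negbK.
apply: le_trans (measureU2 _ (mS _ _) (mS _ _)) _.
by rewrite mulr2n mulrDl mul1r EFinD; apply: leeD.
Qed.

End Gap.

(** * Choice of the parameters *)

Section RateBounds.
Variable R : realType.

Lemma rate_cube_le (t : R) (N : nat) : 0 < t ->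
  ((t * Num.sqrt N%:R) `^ (2 / 3)) ^+ 3 = (t * Num.sqrt N%:R) ^+ 2.
Proof.
move=> t0; have x0 : 0 <= t * Num.sqrt N%:R by rewrite mulr_ge0 ?sqrtr_ge0// ltW.
rewrite -powR_mulrn ?powR_ge0// -powRrM -powR_mulrn//; congr (_ `^ _).
by field.
Qed.

Lemma trivial_rate (C q : R) : 2 <= C -> 2 * q <= C ->
  1 <= C * expR (- (C^-1 * q)).
Proof.
move=> C2 qC; have C0 : 0 < C by lra.
have h : C^-1 * q <= 2^-1 by rewrite ler_pdivrMl//; lra.
have := expR_ge1Dx (- (C^-1 * q)); nra.
Qed.

Lemma exists_level (x : R) : 1 <= x ->
  exists lam : nat, 4 ^+ lam <= x < 4 ^+ lam.+1.
Proof.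
move=> x1; have x0 : 0 <= x by lra.
pose n := Num.truncn x.
have n0 : (0 < n)%N by rewrite /n truncn_gt0.
have /andP[l1 l2] := trunc_log_bounds (isT : (1 < 4)%N) n0.
have /andP[t1 t2] := truncn_itv x0.
exists (trunc_log 4 n); apply/andP; split.
  by apply: le_trans t1; rewrite -natrX ler_nat.
by apply: (lt_le_trans t2); rewrite -natrX ler_nat.
Qed.

End RateBounds.

(** [l0] is the least admissible value. The two inequalities are those of the plain sum and of the
    sum of squares; the second is void when [l0 = 0]. *)
Lemma exists_ceil3 (k lam : nat) : exists2 l0 : nat, (k <= lam + 3 * l0)%N &
  (0 < l0)%N -> (lam + 3 * l0.-1 <= k)%N.
Proof. by exists ((k - lam + 2) %/ 3)%N; lia. Qed.

(** Covers [N = 1], where the indices do not split into two nonempty parts. Passing through the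
    union of the two points, each step uses the local condition at level 1 and costs at most
    [a / 2 * 2]. *)
Lemma single_point_gap (R : realType) (L : {fset R * R} -> R) (a : nat)
    (x y : R * R) : local_condition a%:R L -> unit_square x -> unit_square y ->
  `|L [fset x]%fset - L [fset y]%fset| <= 2 * a%:R.
Proof.
move=> hL.
have h u v : unit_square u -> unit_square v ->
    `|L [fset u]%fset - L ([fset u] `|` [fset v])%fset| <= a%:R.
  move=> usq vsq.
  have lt k (r : R) := @cidx_lt R k r.
  have := hL 1%N (dyadic_square 1 (cidx 1 v.1) (cidx 1 v.2)) [fset u]%fset [fset v]%fset.
  move=> /(_ isT)/(_ _)/(_ _)/(_ _)/(_ _) => h.
  apply: (le_trans (h _ _ _ _)).
  - by exists (cidx 1 v.1), (cidx 1 v.2); split; rewrite ?lt.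
  - by move=> z /=; rewrite inE => /eqP ->.
  - move=> C' [l1 [l2 []]]; rewrite /= expn0 !ltnS !leqn0 => /eqP -> /eqP -> -> _.
    exists u; split; last by rewrite /= inE.
    by move: usq; rewrite /dyadic_square /unit_square expr0 !divr1.
  - by move=> z /=; rewrite inE => /eqP ->; exact: cidx_square.
  set m := #|` _|.
  have m2 : (m <= 2)%N.
    apply: (@leq_trans #|` [fset u] `|` [fset v]|%fset).
      by apply: fsubset_leq_card; apply/fsubsetP => z; rewrite !inE /= => /andP[].
    by apply: leq_trans (leq_card_fsetU _ _) _; rewrite !cardfs1.
  have : m%:R <= 2 :> R by rewrite ler_nat.
  have : 0 <= a%:R :> R by [].
  rewrite expr1; nra.
move=> xs ys; apply: (le_trans (ler_distD (L ([fset x] `|` [fset y])%fset) _ _)).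
rewrite mulr2n mulrDl mul1r; apply: lerD; first exact: h.
by rewrite distrC fsetUC; exact: h.
Qed.

Theorem theorem11p4p2 (R : realType) (kappa : R) :
  exists K : R, 0 < K /\
  forall L : {fset R * R} -> R,
    measurable_functional L ->
    local_condition kappa L ->
    forall (N : nat) (d : measure_display) (T : measurableType d)
      (P : probability T R) (X : 'I_N -> {RV P >-> (R * R)%type}) (M : R),
      (1 <= N)%N ->
      mutually_independent X ->
      (forall i, uniform_on_unit_square (X i)) ->
      let LN := fun w : T => on_points L [tuple X i w | i < N] in
      is_median P LN M ->
      forall t : R, 0 < t ->
        (P [set w | (t <= `|LN w - M|)%R] <=
         (K * expR (- (K^-1 *
            Num.min (t ^+ 2) ((t * Num.sqrt N%:R) `^ (2 / 3)))))%:E)%E.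
Proof.
have [a ka] : exists a : nat, kappa <= a%:R.
  exists (Num.truncn `|kappa|).+1.
  by apply: le_trans (ler_norm _) (ltW (truncnS_gt _)).
have tail0 : 0 <= 2 * tail_const R by rewrite mulr_ge0// ltW// tail_const_gt0.
pose C5 := variance_const a (2 * tail_const R); pose C6 := bad_const a (2 * tail_const R).
have C50 : 0 < C5 by exact: variance_const_gt0.
have C60 : 0 <= C6 by rewrite /C6 /bad_const !mulr_ge0// /neighbor_const ?heavy_const_ge0.
(* Gives [C6 * eta <= 1/2], by which the bound on [8 ^+ lam] below implies the hypothesis of
   [gap_tail]. *)
pose eta := (1 + 2 * C6)^-1.
have eta0 : 0 < eta by rewrite invr_gt0; lra.
have eta1 : eta <= 1 by rewrite invf_le1; lra.
have C6eta : C6 * eta <= 2^-1 by rewrite ler_pdivrMr; lra.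
pose delta := eta ^+ 2.
have delta0 : 0 < delta by rewrite exprn_gt0.
(* [6160 = 4 * 2 * (768 + 2)] collects the prefactors of [median_gap] and [gap_tail]; [192 / delta]
   is [4 * 48 / delta], with 4 for the rounding of [lam]; [32 * C5] comes from the exponent at
   [t / 2]; [8 * a^2] settles [N = 1] with [t <= 2 * a]. *)
have [C [CA CB CC CD]] : exists C : R,
    [/\ 6160 <= C, 192 / delta <= C, 32 * C5 <= C & 8 * a%:R ^+ 2 <= C].
  have i0 : 0 < 192 / delta by rewrite divr_gt0.
  have a20 : 0 <= 8 * a%:R ^+ 2 :> R by rewrite mulr_ge0 ?sqr_ge0.
  exists (6160 + 192 / delta + 32 * C5 + 8 * a%:R ^+ 2).
  have C5p : 0 < 32 * C5 by rewrite mulr_gt0.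
  move: (192 / delta) (32 * C5) (8 * _) i0 a20 C5p => x y z x0 z0 y0.
  by split; lra.
have C0 : 0 < C by apply: lt_le_trans CA; rewrite ltr0n.
exists C; split => // L L_meas hL N d T P X M N1 X_indep X_unif LN med t t0.
have L_local := local_condition_le ka hL.
set q := Num.min _ _.
have qt : q <= t ^+ 2 by rewrite ge_min lexx.
have q0 : 0 <= q by rewrite le_min sqr_ge0 powR_ge0.
have mLN : measurable_fun setT LN by exact: measurable_LN.
have mE : measurable [set w | t <= `|LN w - M|].
  have mh : measurable_fun setT (fun w => `|LN w - M|).
    by apply: measurableT_comp => //; exact: measurable_funB.
  rewrite (_ : mkset _ = (fun w => `|LN w - M|) @^-1` `[t, +oo[).
    by rewrite -[Y in measurable Y]setTI; apply: mh => //; exact: measurable_itv.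
  by apply/seteqP; split=> w /=; rewrite in_itv/= andbT.
have trivial : 2 * q <= C ->
    (P [set w | (t <= `|LN w - M|)%R] <= (C * expR (- (C^-1 * q)))%:E)%E.
  move=> qC; apply: le_trans (probability_le1 P mE) _.
  by rewrite lee_fin; apply: trivial_rate => //; apply: le_trans CA; rewrite ler_nat.
have [N2|N2] := ltnP 1 N; last first.
  have NE : N = 1%N by apply/eqP; rewrite eqn_leq N2.
  have gap w w' : `|LN w - LN w'| <= 2 * a%:R.
    have e w0 : LN w0 = L [fset X (cast_ord (esym NE) ord0) w0]%fset.
      congr L; apply/fsetP => z; rewrite inE; apply/imfsetP/eqP => [[i /= _ ->]|->].
        rewrite tnth_mktuple; congr (X _ w0); apply/val_inj => /=.
        by case: i => i /= iN; apply/eqP; rewrite -leqn0 -ltnS -NE.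
      by exists (cast_ord (esym NE) ord0) => //; rewrite tnth_mktuple.
    by rewrite !e; apply: single_point_gap => //; exact: (X_unif _).1.
  have [ta|ta] := leP t (2 * a%:R).
    apply: trivial; apply: le_trans CD.
    have : t ^+ 2 <= (2 * a%:R) ^+ 2.
      by rewrite lerXn2r ?nnegrE ?(ltW t0)// mulr_ge0.
    rewrite exprMn => h; have := le_trans qt h.
    by move: (_%:R ^+ 2) => x; lra.
  (* The median lies between two values of [LN], so that no deviation from it exceeds the range
     [2 * a]. *)
  have nonempty (A : set T) : (2^-1%:E <= P A)%E -> A !=set0.
    move=> PA; apply/set0P/negP => /eqP A0; move: PA.
    by rewrite A0 measure0 lee_fin; lra.
  have [w1 /= h1] := nonempty _ med.1; have [w2 /= h2] := nonempty _ med.2.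
  rewrite (_ : mkset _ = set0); first by rewrite measure0 lee_fin mulr_ge0 ?expR_ge0// ltW.
  apply/seteqP; split=> w //=.
  have := gap w w1; have := gap w w2; rewrite !ler_norml ler_normr.
  move=> /andP[g1 g2] /andP[g3 g4] /orP[h|h]; lra.
(* Below 1 there is no power [4 ^+ lam] to choose; then [q] is bounded and the prefactor makes the
   estimate trivial. *)
have [dq|dq] := ltP (delta * q) 1.
  apply: trivial; have : q <= delta^-1 by rewrite -[leRHS]mul1r ler_pdivlMr// mulrC ltW.
  move=> h; apply: le_trans CB; move: h; move: (delta^-1) => x.
  by have := q0; lra.
have [lam /andP[lam1 lam2]] := exists_level dq.
have N0 : (0 < N)%N by exact: ltnW.
pose K := trunc_log 4 N.
have /andP[N_ge N_lt] := trunc_log_bounds (isT : (1 < 4)%N) N0.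
have [l0 hl1 hl2] := exists_ceil3 K.+1 lam.
have sN0 : 0 <= Num.sqrt N%:R :> R by exact: sqrtr_ge0.
have tN0 : 0 <= t * Num.sqrt N%:R by rewrite mulr_ge0// ltW.
have q3 : q ^+ 3 <= (t * Num.sqrt N%:R) ^+ 2.
  rewrite -rate_cube_le// lerXn2r ?nnegrE ?powR_ge0//.
  by rewrite ge_min lexx orbT.
(* Compared after squaring: [(8^lam)^2 = (4^lam)^3 <= (delta * q)^3], where [delta^3 = eta^6] and
   [q^3] is at most the square of [t * sqrt N]. *)
have lam8 : 8 ^+ lam <= eta ^+ 3 * (t * Num.sqrt N%:R).
  rewrite -(@ler_pXn2r _ 2) ?nnegrE ?exprn_ge0 ?mulr_ge0 ?exprn_ge0 ?(ltW eta0) ?(ltW t0)//.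
  have -> : (8 ^+ lam) ^+ 2 = (4 ^+ lam) ^+ 3 :> R.
    by rewrite exprAC [RHS]exprAC; congr (_ ^+ _); ring.
  apply: (@le_trans _ _ ((delta * q) ^+ 3)).
    by rewrite lerXn2r ?nnegrE ?exprn_ge0// mulr_ge0// ltW.
  rewrite exprMn [leRHS]exprMn /delta exprAC.
  by apply: ler_wpM2l q3; rewrite !exprn_ge0// ltW.
have sqrtN : Num.sqrt N%:R <= 2 ^+ K.+1 :> R.
  rewrite -(@ger0_norm _ (2 ^+ K.+1)) ?exprn_ge0// -sqrtr_sqr ler_wsqrtr//.
  rewrite exprAC (_ : 2 ^+ 2 = 4); last by ring.
  by rewrite -natrX ler_nat ltnW.
have ht : bad_const a (2 * tail_const R) * 8 ^+ lam / 2 ^+ K.+1 <= t / 2.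
  rewrite -/C6 ler_pdivrMr ?exprn_gt0//.
  apply: (le_trans (ler_wpM2l C60 lam8)).
  have e3 : eta ^+ 3 <= eta by rewrite -[leRHS]expr1 ler_wiXn2l// ltW.
  apply: (@le_trans _ _ (C6 * (eta * (t * 2 ^+ K.+1)))).
    rewrite ler_wpM2l// ler_pM ?exprn_ge0 ?(ltW eta0)//.
    by rewrite ler_wpM2l// ltW.
  rewrite mulrA [leRHS]mulrAC mulrC.
  have p0 : 0 <= t * 2 ^+ K.+1 by rewrite mulr_ge0 ?exprn_ge0// ltW.
  by rewrite ler_wpM2l.
have := gap_tail L_meas L_local X_indep X_unif N2 N_lt N_ge t0 hl1 hl2 ht.
move=> /(median_gap mLN med t0) hP; apply: (le_trans hP).
rewrite lee_fin -/C5.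
have e1 : expR (- (4 ^+ lam / 48)) <= expR (- (C^-1 * q)).
  rewrite ler_expR lerN2 ler_pdivrMl//.
  have h1 : q <= 4 ^+ lam.+1 / delta by rewrite ler_pdivlMr// mulrC ltW.
  apply: (le_trans h1).
  have -> : 4 ^+ lam.+1 / delta = (192 / delta) * (4 ^+ lam / 48).
    by rewrite exprS; field; rewrite gt_eqF.
  by rewrite ler_wpM2r ?divr_ge0 ?exprn_ge0.
have e2 : expR (- ((t / 2) ^+ 2 / (8 * C5))) <= expR (- (C^-1 * q)).
  rewrite ler_expR lerN2 ler_pdivrMl//.
  have -> : (t / 2) ^+ 2 / (8 * C5) = t ^+ 2 / (32 * C5).
    by field; rewrite gt_eqF.
  rewrite mulrA ler_pdivlMr ?mulr_gt0// mulrC.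
  by apply: ler_pM => //; rewrite mulr_ge0// ltW.
have x0 := expR_gt0 (- (C^-1 * q)).
move: e1 e2 x0; move: (expR (- (4 ^+ lam / 48))) (expR (- ((t / 2) ^+ 2 / (8 * C5))))
  (expR (- (C^-1 * q))) => x y z e1 e2 x0.
apply: (@le_trans _ _ (6160 * z)); first lra.
by rewrite ler_wpM2r// ltW.
Qed.
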